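(* Let $d\geq 2$ and let $\mathfrak{g}$ be a Lifshitz Lie algebra of dimension $d(d+1)/2+2$ (as defined in the context). Then $\mathfrak{g}$ is isomorphic to precisely one Lie algebra in the following list. Each algebra in the list has basis $J_{ab}=-J_{ba}$, $P_a$, $H$, $D$ ($a,b=1,\dots,d$), with the common brackets \[ [J_{ab},J_{cd}] = \delta_{bc} J_{ad} - \delta_{ac} J_{bd} - \delta_{bd} J_{ac} + \delta_{ad} J_{bc},\qquad [J_{ab},P_c]=\delta_{bc}P_a-\delta_{ac}P_b,\qquad [J_{ab},H]=[J_{ab},D]=0, \] and in addition only the following nonzero brackets (all brackets not listed and not determined by antisymmetry vanish): \begin{itemize} \item $\mathfrak{a}_1$ ($d\geq 2$): no further nonzero brackets; \item $\mathfrak{a}_2$ ($d\geq 2$): $[D,H]=H$; \item $\mathfrak{a}_3^z$ ($d\geq 2$), for a parameter $z\in\mathbb{R}$: $[D,H]=zH$, $[D,P_a]=P_a$; \item $\mathfrak{a}_4^\pm$ ($d\geq 2$): $[P_a,P_b]=\pm J_{ab}$; \item $\mathfrak{a}_5^\pm$ ($d\geq 2$): $[D,H]=H$, $[P_a,P_b]=\pm J_{ab}$; \item $\mathfrak{a}_6$ (only $d=2$): $[P_a,P_b]=\epsilon_{ab}H$; \item $\mathfrak{a}_7$ (only $d=2$): $[D,H]=2H$, $[D,P_a]=P_a$, $[P_a,P_b]=\epsilon_{ab}H$. \end{itemize}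
   Context: A Lifshitz Lie algebra is a real Lie algebra $\mathfrak{g}$ of dimension $d(d+1)/2+2$ with a basis $J_{ab}=-J_{ba}$, $P_a$, $H$, $D$ ($a,b=1,\dots,d$) such that the $J_{ab}$ span a Lie subalgebra isomorphic to $\mathfrak{so}(d)$ with brackets $[J_{ab},J_{cd}] = \delta_{bc} J_{ad} - \delta_{ac} J_{bd} - \delta_{bd} J_{ac} + \delta_{ad} J_{bc}$, under which the $P_a$ transform as a vector, $[J_{ab},P_c]=\delta_{bc}P_a-\delta_{ac}P_b$, and $H$ and $D$ transform as scalars, $[J_{ab},H]=[J_{ab},D]=0$; the remaining brackets are arbitrary subject only to the Jacobi identity. $\epsilon_{ab}$ denotes the Levi-Civita symbol in two dimensions. *)

(* Defs.v *)
From HB Require Import structures.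
From mathcomp Require Import all_boot all_order all_algebra.
From mathcomp Require Import reals.
Set Implicit Arguments. Unset Strict Implicit. Unset Printing Implicit Defensive.
Import Order.TTheory GRing.Theory Num.Theory.
Local Open Scope ring_scope.

(** Labels of the algebras in the list of Theorem 3.2:
    LA1 = a_1, LA2 = a_2, LA3 z = a_3^z, LA4 s = a_4^{+} (s = true) / a_4^{-} (s = false),
    LA5 s = a_5^{+/-}, LA6 = a_6, LA7 = a_7. *)
Inductive lifshitz_label (R : Type) :=
  | LA1 | LA2 | LA3 of R | LA4 of bool | LA5 of bool | LA6 | LA7.
Arguments LA1 {R}. Arguments LA2 {R}. Arguments LA6 {R}. Arguments LA7 {R}.

Definition admissible (R : Type) (d : nat) (L : lifshitz_label R) : Prop :=
  match L with LA6 | LA7 => d = 2%N | _ => True end.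

(** Index set of the basis J_ab (a<b), P_a, H (false), D (true). *)
Notation Jidx d := {p : 'I_d * 'I_d | (val p.1 < val p.2)%N}.
Notation Idx d := (Jidx d + ('I_d + bool))%type.

Section Lifshitz.
Variables (R : realType) (d : nat).

Definition delta (a b : 'I_d) : R := (a == b)%:R.

(** Two-dimensional Levi-Civita symbol (meaningful for d = 2). *)
Definition eps2 (a b : 'I_d) : R :=
  ((val a == 0%N) && (val b == 1%N))%:R - ((val a == 1%N) && (val b == 0%N))%:R.

Local Notation coord := {ffun Idx d -> R^o}.
Definition ev (i : Idx d) : coord := [ffun j => (j == i)%:R].

Definition mJ (a b : 'I_d) : coord :=
  match @insub _ (fun p : 'I_d * 'I_d => (val p.1 < val p.2)%N) (Jidx d) (a, b) with
  | Some p => ev (inl p)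
  | None =>
    match @insub _ (fun p : 'I_d * 'I_d => (val p.1 < val p.2)%N) (Jidx d) (b, a) with
    | Some p => - ev (inl p)
    | None => 0
    end
  end.
Definition mP (a : 'I_d) : coord := ev (inr (inl a)).
Definition mH : coord := ev (inr (inr false)).
Definition mD : coord := ev (inr (inr true)).

Definition DHc (L : lifshitz_label R) : R :=   (* [D,H] = DHc H *)
  match L with LA2 => 1 | LA3 z => z | LA5 _ => 1 | LA7 => 2%:R | _ => 0 end.
Definition DPc (L : lifshitz_label R) : R :=   (* [D,P_a] = DPc P_a *)
  match L with LA3 _ => 1 | LA7 => 1 | _ => 0 end.
Definition PPJ (L : lifshitz_label R) : R :=   (* J-part of [P_a,P_b] *)
  match L with LA4 s => (if s then 1 else -1) | LA5 s => (if s then 1 else -1) | _ => 0 end.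
Definition PPH (L : lifshitz_label R) : R :=   (* H-part of [P_a,P_b] = PPH eps_ab H *)
  match L with LA6 => 1 | LA7 => 1 | _ => 0 end.

Definition JJbr (a b c e : 'I_d) : coord :=
  delta b c *: mJ a e - delta a c *: mJ b e - delta b e *: mJ a c + delta a e *: mJ b c.
Definition JPbr (a b c : 'I_d) : coord := delta b c *: mP a - delta a c *: mP b.

Definition bb (L : lifshitz_label R) (i j : Idx d) : coord :=
  match i, j with
  | inl p, inl q => JJbr (val p).1 (val p).2 (val q).1 (val q).2
  | inl p, inr (inl c) => JPbr (val p).1 (val p).2 c
  | inr (inl c), inl p => - JPbr (val p).1 (val p).2 c
  | inl _, inr (inr _) => 0
  | inr (inr _), inl _ => 0
  | inr (inl a), inr (inl b) => PPJ L *: mJ a b + (PPH L * eps2 a b) *: mH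
  | inr (inr true), inr (inl a) => DPc L *: mP a
  | inr (inl a), inr (inr true) => - (DPc L *: mP a)
  | inr (inr false), inr (inl _) => 0
  | inr (inl _), inr (inr false) => 0
  | inr (inr true), inr (inr false) => DHc L *: mH
  | inr (inr false), inr (inr true) => - (DHc L *: mH)
  | inr (inr true), inr (inr true) => 0
  | inr (inr false), inr (inr false) => 0
  end.

Definition mbr (L : lifshitz_label R) (x y : coord) : coord :=
  \sum_(i : Idx d) \sum_(j : Idx d) (x i * y j) *: bb L i j.

Definition is_lie_bracket (V : lmodType R) (br : V -> V -> V) : Prop :=
  [/\ (forall (a : R) x y z, br (a *: x + y) z = a *: br x z + br y z),
      (forall (a : R) x y z, br z (a *: x + y) = a *: br z x + br z y),
      (forall x, br x x = 0) &
      (forall x y z, br x (br y z) + br y (br z x) + br z (br x y) = 0)].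

Definition lif_family (V : lmodType R) (J : 'I_d -> 'I_d -> V) (P : 'I_d -> V)
  (H D : V) (i : Idx d) : V :=
  match i with
  | inl p => J (val p).1 (val p).2
  | inr (inl a) => P a
  | inr (inr b) => if b then D else H
  end.

Definition is_basis (V : lmodType R) (b : Idx d -> V) : Prop :=
  bijective (fun c : coord => \sum_(i : Idx d) c i *: b i).

Definition lifshitz_lie_algebra (V : lmodType R) (br : V -> V -> V)
  (J : 'I_d -> 'I_d -> V) (P : 'I_d -> V) (H D : V) : Prop :=
  [/\ is_lie_bracket br,
      (forall a b, J a b = - J b a),
      is_basis (lif_family J P H D),
      (forall a b c e, br (J a b) (J c e) =
         delta b c *: J a e - delta a c *: J b e - delta b e *: J a c + delta a e *: J b c) &
      (forall a b c, br (J a b) (P c) = delta b c *: P a - delta a c *: P b)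
      /\ (forall a b, br (J a b) H = 0 /\ br (J a b) D = 0)].

Definition iso_to_model (V : lmodType R) (br : V -> V -> V) (L : lifshitz_label R) : Prop :=
  exists f : V -> coord,
    [/\ (forall (a : R) x y, f (a *: x + y) = a *: f x + f y),
        bijective f &
        (forall x y, f (br x y) = mbr L (f x) (f y))].

End Lifshitz.

(* Main.v *)
Require Import Defs.
From HB Require Import structures.
From mathcomp Require Import all_boot all_order all_algebra.
From mathcomp Require Import reals ring lra.
Set Implicit Arguments. Unset Strict Implicit. Unset Printing Implicit Defensive.
Import Order.TTheory GRing.Theory Num.Theory.
Local Open Scope ring_scope.

(** Give each basis vector its set S of rotation indices: {a, b} for J_ab, {a} for P_a
    and the empty set for H and D.  The operators (ad J_ab)^2 are diagonal in the basis,
    with eigenvalue -1 if exactly one of a, b lies in S and 0 otherwise, so that they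
    determine S up to complement.  Hence [D, H], [D, P_a] and [P_a, P_b] have few possible
    components.  The exceptional ones, which occur in dimensions 2, 3 and 4, are either
    excluded by the Jacobi identity or absorbed by shifting P, H, D or J, and a change of
    basis in the span of H and D together with a rescaling gives the normal forms.

    For uniqueness, the Killing form is diagonal in such a basis: negative on the J_ab,
    of the sign of the coefficient s of J in [P, P] on the P_a, zero on H, and
    z^2 + d p^2 on D, where [D, H] = z H and [D, P] = p P.  Its sign and radical, the trace
    of the adjoint representation and the character by which the algebra acts on the
    line of H recover the label. *)

(** Over the reals ad J_ab has no eigenvectors outside its kernel, which is why its square is used.
    For d >= 3 the bracket [P, P] is normalized before the action of H and D is computed: the J
    component that [D, P_a] may have in dimension three is excluded by applying ad D to [P_a, P_b] =
    l J_ab, an identity available only after P has been shifted. In dimension two the order is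
    reversed: J_01 is itself rotation invariant, so H and D are corrected along J first. The
    isomorphisms in the uniqueness claim are abstract and need not respect rotations, so weights
    cannot be compared across them. Both models are pulled back to two bases of one algebra, and
    only intrinsic data are compared. The Killing form is diagonal because the reflection of each
    coordinate axis is an automorphism of a normal form: basis vectors told apart by some reflection
    are orthogonal. Only H is not always told apart in this way, and it lies in the radical. *)

Lemma eq_oppv_eq0 (R : realType) (V : lmodType R) (x : V) : x = - x -> x = 0.
Proof.
move=> /eqP; rewrite -subr_eq0 opprK -mulr2n -scaler_nat scaler_eq0 pnatr_eq0.
by move=> /eqP.
Qed.

(** * Calculus of a Lie bracket *)

Section LieBracket.
Variables (R : realType) (V : lmodType R) (br : V -> V -> V).
Hypothesis lie : is_lie_bracket br.

Lemma brDl x y z : br (x + y) z = br x z + br y z.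
Proof. by case: lie => l _ _ _; have := l 1 x y z; rewrite !scale1r. Qed.

Lemma brDr x y z : br z (x + y) = br z x + br z y.
Proof. by case: lie => _ l _ _; have := l 1 x y z; rewrite !scale1r. Qed.

Lemma br0l z : br 0 z = 0.
Proof. by apply: (addrI (br 0 z)); rewrite -brDl !addr0. Qed.

Lemma br0r z : br z 0 = 0.
Proof. by apply: (addrI (br z 0)); rewrite -brDr !addr0. Qed.

Lemma brZl a x z : br (a *: x) z = a *: br x z.
Proof. by case: lie => l _ _ _; have := l a x 0 z; rewrite br0l !addr0. Qed.

Lemma brZr a x z : br z (a *: x) = a *: br z x.
Proof. by case: lie => _ l _ _; have := l a x 0 z; rewrite br0r !addr0. Qed.

Lemma brNl x z : br (- x) z = - br x z.
Proof. by rewrite -scaleN1r brZl scaleN1r. Qed.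

Lemma brNr x z : br z (- x) = - br z x.
Proof. by rewrite -scaleN1r brZr scaleN1r. Qed.

Lemma brxx x : br x x = 0.
Proof. by case: lie. Qed.

Lemma brC x y : br x y = - br y x.
Proof.
apply/eqP; rewrite -subr_eq0 opprK; apply/eqP.
by have := brxx (x + y); rewrite brDl !brDr !brxx add0r addr0.
Qed.

Lemma br_derivation x y z : br x (br y z) = br (br x y) z + br y (br x z).
Proof.
case: lie => _ _ _ /(_ x y z) /eqP.
rewrite (brC z x) brNr (brC z (br x y)) -addrA -opprD subr_eq0 => /eqP ->.
by rewrite addrC.
Qed.

Lemma br_suml (I : finType) (c : I -> R) (u : I -> V) y :
  br (\sum_i c i *: u i) y = \sum_i c i *: br (u i) y.
Proof.
rewrite (big_morph (fun x => br x y) (fun u v => brDl u v y) (br0l y)).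
by apply: eq_bigr => i _; rewrite brZl.
Qed.

Lemma br_sumr (I : finType) (c : I -> R) (u : I -> V) y :
  br y (\sum_i c i *: u i) = \sum_i c i *: br y (u i).
Proof.
rewrite (big_morph (br y) (fun u v => brDr u v y) (br0r y)).
by apply: eq_bigr => i _; rewrite brZr.
Qed.

Definition brE := (brDl, brDr, brZl, brZr, brNl, brNr, br0l, br0r).

End LieBracket.

(** * Coordinates in a basis, spanning families and traces *)

Section Coordinates.
Variables (R : realType) (d : nat) (V : lmodType R).
Implicit Types (b : Idx d -> V) (co : V -> Idx d -> R) (x y : V).

Definition comb b (c : {ffun Idx d -> R^o}) : V := \sum_i c i *: b i.

(** Dual functionals rather than the inverse of the expansion map: identities in [V] are proved and
    exploited one component at a time. *)
Definition coordinates b co :=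
  [/\ forall a x y i, co (a *: x + y) i = a * co x i + co y i,
      forall i j, co (b i) j = (j == i)%:R &
      forall x, x = \sum_i co x i *: b i].

Lemma combP b a (x y : {ffun Idx d -> R^o}) :
  comb b (a *: x + y) = a *: comb b x + comb b y.
Proof.
rewrite /comb scaler_sumr -big_split; apply: eq_bigr => i _.
by rewrite !ffunE scalerDl scalerA.
Qed.

Lemma comb_ev b i : comb b (ev R i) = b i.
Proof.
rewrite /comb (bigD1 i) //= ffunE eqxx scale1r big1 ?addr0 // => j /negPf ji.
by rewrite ffunE ji scale0r.
Qed.

Lemma basis_coordinates b : is_basis b -> exists co, coordinates b co.
Proof.
move=> [g gK Kg]; exists (fun x i => g x i); split=> [a x y i|i j|x].
- have -> : g (a *: x + y) = a *: g x + g y.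
    by apply: (can_inj gK); rewrite Kg [RHS]combP /comb !Kg.
  by rewrite !ffunE.
- by rewrite -(comb_ev b i) /comb gK ffunE.
- by rewrite -{1}(Kg x).
Qed.

Section Theory.
Variables (b : Idx d -> V) (co : V -> Idx d -> R).
Hypothesis bco : coordinates b co.

Lemma co0 i : co 0 i = 0.
Proof.
case: bco => l _ _; have := l 1 0 0 i.
rewrite scale1r addr0 mul1r => e.
by apply: (addrI (co 0 i)); rewrite -e addr0.
Qed.

Lemma coD x y i : co (x + y) i = co x i + co y i.
Proof. by case: bco => l _ _; rewrite -[x in LHS]scale1r l mul1r. Qed.

Lemma coZ a x i : co (a *: x) i = a * co x i.
Proof. by case: bco => l _ _; rewrite -[a *: x]addr0 l co0 addr0. Qed.

Lemma coN x i : co (- x) i = - co x i.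
Proof. by rewrite -scaleN1r coZ mulN1r. Qed.

Lemma co_basis i j : co (b i) j = (j == i)%:R.
Proof. by case: bco. Qed.

Lemma coK x : \sum_i co x i *: b i = x.
Proof. by case: bco => _ _ /(_ x). Qed.

Lemma co_inj x y : (forall i, co x i = co y i) -> x = y.
Proof.
by move=> e; rewrite -(coK x) -(coK y); apply: eq_bigr => i _; rewrite e.
Qed.

Lemma co_sum (I : finType) (c : I -> R) (u : I -> V) j :
  co (\sum_i c i *: u i) j = \sum_i c i * co (u i) j.
Proof.
rewrite (big_morph (fun x => co x j) (fun u v => coD u v j) (co0 j)).
by apply: eq_bigr => i _; rewrite coZ.
Qed.

Lemma basis_neq0 i : b i != 0.
Proof.
apply/eqP => e; have := co_basis i i.
by rewrite e co0 eqxx => /esym/eqP; rewrite oner_eq0.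
Qed.

Definition coE := (coD, coZ, coN, co0).
End Theory.

Definition spanned b x := exists c, x = comb b c.

Lemma spannedZD b a x y : spanned b x -> spanned b y -> spanned b (a *: x + y).
Proof. by move=> [u ->] [v ->]; exists (a *: u + v); rewrite combP. Qed.

Lemma spanned0 b : spanned b 0.
Proof. by exists 0; rewrite /comb big1 // => i _; rewrite ffunE scale0r. Qed.

Lemma spannedD b x y : spanned b x -> spanned b y -> spanned b (x + y).
Proof. by move=> sx sy; rewrite -[x]scale1r; apply: spannedZD. Qed.

Lemma spannedZ b a x : spanned b x -> spanned b (a *: x).
Proof. by move=> sx; rewrite -[_ *: _]addr0; apply/spannedZD/spanned0. Qed.

Lemma spannedN b x : spanned b x -> spanned b (- x).
Proof. by move=> sx; rewrite -scaleN1r; apply: spannedZ. Qed.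

Lemma spanned_basis b i : spanned b (b i).
Proof. by exists (ev R i); rewrite comb_ev. Qed.

(** A surjective endomorphism of a finite-dimensional space is injective. [V] is a bare module, so
    rank-nullity is applied on the coordinate space, to the map [M] that expresses [b'] in the
    coordinates of [b]. *)
Lemma spanning_family_basis b b' :
  is_basis b -> (forall i, spanned b' (b i)) -> is_basis b'.
Proof.
move=> /basis_coordinates[co bco] sp.
pose M (c : {ffun Idx d -> R^o}) : {ffun Idx d -> R^o} := [ffun i => co (comb b' c) i].
have linM : linear M.
  by move=> a x y; apply/ffunP => i; rewrite !ffunE combP !(coE bco).
pose Mlin : {linear {ffun Idx d -> R^o} -> {ffun Idx d -> R^o}} :=
  HB.pack M (GRing.isLinear.Build _ _ _ _ M linM).
pose f := linfun Mlin.
have fE c : f c = M c by rewrite lfunE.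
have spanT x : spanned b' x.
  rewrite -(coK bco x); apply: big_ind => [||i _].
  - exact: spanned0.
  - exact: spannedD.
  - exact/spannedZ/sp.
have imf (y : {ffun Idx d -> R^o}) : y \in limg f.
  have [c cE] := spanT (comb b y).
  have -> : y = f c; last by rewrite memv_img ?memvf.
  rewrite fE; apply/ffunP => i; rewrite ffunE -cE /comb (co_sum bco).
  rewrite (bigD1 i) //= (co_basis bco) eqxx mulr1 big1 ?addr0 // => j /negPf ji.
  by rewrite (co_basis bco) eq_sym ji mulr0.
have kerf : lker f == 0%VS.
  have imT : limg f = fullv by apply/vspaceP => y; rewrite imf memvf.
  have := limg_ker_dim f fullv; rewrite capfv imT => /(canRL (addnK _)).
  by rewrite subnn => /eqP; rewrite dimv_eq0.
exists (fun x => (f^-1)%VF [ffun i => co x i]) => [c|x].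
  have -> : [ffun i => co (\sum_i c i *: b' i) i] = f c by rewrite fE.
  by rewrite lker0_lfunK.
apply: (co_inj bco) => i.
have := limg_lfunVK (imf [ffun i => co x i]).
by rewrite fE => /ffunP/(_ i); rewrite !ffunE.
Qed.

Definition trace_in b co (g : V -> V) : R := \sum_i co (g (b i)) i.

Lemma trace_in_change b co b' co' (g : V -> V) :
  coordinates b co -> coordinates b' co' ->
  (forall a x y, g (a *: x + y) = a *: g x + g y) ->
  trace_in b co g = trace_in b' co' g.
Proof.
move=> bco bco' lin.
have g0 : g 0 = 0.
  have := lin 1 0 0; rewrite !scale1r addr0 => e.
  by apply: (addrI (g 0)); rewrite -e addr0.
have gD x y : g (x + y) = g x + g y by rewrite -[x in LHS]scale1r lin scale1r.
have gsum (c : Idx d -> R) u : g (\sum_i c i *: u i) = \sum_i c i *: g (u i).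
  rewrite (big_morph g gD g0); apply: eq_bigr => i _.
  by rewrite -[_ *: _]addr0 lin g0 addr0.
(* Expanding [b i] in [b'] on the left and [g (b' j)] in [b] on the right produces the same double
   sum. *)
transitivity (\sum_i \sum_j co' (b i) j * co (g (b' j)) i).
  by apply: eq_bigr => i _; rewrite -{1}(coK bco' (b i)) gsum (co_sum bco).
rewrite exchange_big; apply: eq_bigr => j _ /=.
rewrite -{2}(coK bco (g (b' j))) (co_sum bco').
by apply: eq_bigr => i _; rewrite mulrC.
Qed.

End Coordinates.

(** The shape common to all listed algebras, which differ only in the four numbers. The restriction
    of the epsilon term to d = 2 is imposed separately, through admissibility of the label. *)
Definition normal_form (R : realType) (d : nat) (V : lmodType R) (br : V -> V -> V)
  (J : 'I_d -> 'I_d -> V) (P : 'I_d -> V) (H D : V) (s m z p : R) : Prop :=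
  [/\ lifshitz_lie_algebra br J P H D,
      forall a b, br (P a) (P b) = s *: J a b + (m * eps2 R a b) *: H,
      forall a, br D (P a) = p *: P a,
      forall a, br H (P a) = 0 &
      br D H = z *: H].

(** * Isomorphism with a model as existence of a normal form *)

Section Models.
Variables (R : realType) (d : nat).
Implicit Types (L : lifshitz_label R) (a b c e : 'I_d) (x y z : {ffun Idx d -> R^o}).

Lemma mJ_lt a b : (val a < val b)%N ->
  exists p : Jidx d, val p = (a, b) /\ mJ R a b = ev R (inl p).
Proof.
move=> ab; rewrite /mJ; case: insubP => [p _ pE|]; last by rewrite ab.
by exists p.
Qed.

Lemma mJ_diag a : mJ R a a = 0.
Proof. by rewrite /mJ; case: insubP => [p|]; rewrite /= ?ltnn. Qed.

Lemma mJN a b : mJ R a b = - mJ R b a.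
Proof.
rewrite /mJ; case: insubP => [p /= ab pE|/= ab].
  case: insubP => [q /= ba qE|/= ba]; last by rewrite opprK.
  by move: (ltn_trans ab ba); rewrite ltnn.
by case: insubP => [q /= ba qE|/= ba]; rewrite ?oppr0.
Qed.

(** [mJ] is defined by cases on the order of its indices; this principle confines that case split to
    one place. *)
Lemma mJ_ind (Q : 'I_d -> 'I_d -> {ffun Idx d -> R^o} -> Prop) :
  (forall p : Jidx d, Q (val p).1 (val p).2 (ev R (inl p))) ->
  (forall a b x, Q a b x -> Q b a (- x)) ->
  (forall a, Q a a 0) ->
  forall a b, Q a b (mJ R a b).
Proof.
move=> Qlt QN Q0 a b; case: (ltngtP a b) => [ab|ba|/val_inj->].
- have [p [pE ->]] := mJ_lt ab.
  by have := Qlt p; rewrite pE.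
- have [p [pE e]] := mJ_lt ba.
  by rewrite mJN e; apply: QN; have := Qlt p; rewrite pE.
- by rewrite mJ_diag.
Qed.

Lemma mbr_linl L k x y z : mbr L (k *: x + y) z = k *: mbr L x z + mbr L y z.
Proof.
rewrite /mbr scaler_sumr -big_split; apply: eq_bigr => i _ /=.
rewrite scaler_sumr -big_split; apply: eq_bigr => j _ /=.
by rewrite !ffunE scalerA -scalerDl mulrDl mulrA.
Qed.

Lemma mbr_linr L k x y z : mbr L z (k *: x + y) = k *: mbr L z x + mbr L z y.
Proof.
rewrite /mbr scaler_sumr -big_split; apply: eq_bigr => i _ /=.
rewrite scaler_sumr -big_split; apply: eq_bigr => j _ /=.
by rewrite !ffunE scalerA -scalerDl mulrDr mulrCA.
Qed.

Lemma mbr0l L z : mbr L 0 z = 0.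
Proof.
by rewrite /mbr big1 // => i _; rewrite big1 // => j _; rewrite ffunE mul0r scale0r.
Qed.

Lemma mbr0r L z : mbr L z 0 = 0.
Proof.
by rewrite /mbr big1 // => i _; rewrite big1 // => j _; rewrite ffunE mulr0 scale0r.
Qed.

Lemma mbrNl L x z : mbr L (- x) z = - mbr L x z.
Proof. by rewrite -[- x]addr0 -scaleN1r mbr_linl mbr0l addr0 scaleN1r. Qed.

Lemma mbrNr L x z : mbr L z (- x) = - mbr L z x.
Proof. by rewrite -[- x]addr0 -scaleN1r mbr_linr mbr0r addr0 scaleN1r. Qed.

Lemma mbr_ev L (i j : Idx d) : mbr L (ev R i) (ev R j) = bb L i j.
Proof.
rewrite /mbr (bigD1 i) //= [X in _ + X]big1 => [|k /negPf ki]; last first.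
  by rewrite big1 // => l _; rewrite ffunE ki mul0r scale0r.
rewrite addr0 (bigD1 j) //= [X in _ + X]big1 => [|k /negPf kj]; last first.
  by rewrite [ev R j k]ffunE kj mulr0 scale0r.
by rewrite !ffunE !eqxx mulr1 scale1r addr0.
Qed.

Lemma mbr_mJ_mJ L a b c e : mbr L (mJ R a b) (mJ R c e) = JJbr R a b c e.
Proof.
apply: (mJ_ind (Q := fun a b x => mbr L x (mJ R c e) = JJbr R a b c e))
  => [p|{}a {}b x|{}a].
- apply: (mJ_ind (Q := fun c e x => mbr L (ev R (inl p)) x = JJbr R _ _ c e))
    => [q|{}c {}e x|{}c].
  + by rewrite mbr_ev.
  + by rewrite mbrNr => ->; apply/ffunP => i; rewrite !ffunE; ring.
  + by rewrite mbr0r; apply/ffunP => i; rewrite !ffunE; ring.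
- by rewrite mbrNl => ->; apply/ffunP => i; rewrite !ffunE; ring.
- by rewrite mbr0l; apply/ffunP => i; rewrite !ffunE; ring.
Qed.

Lemma mbr_mJ_mP L a b c : mbr L (mJ R a b) (mP R c) = JPbr R a b c.
Proof.
apply: (mJ_ind (Q := fun a b x => mbr L x (mP R c) = JPbr R a b c))
  => [p|{}a {}b x|{}a].
- by rewrite mbr_ev.
- by rewrite mbrNl => ->; apply/ffunP => i; rewrite !ffunE; ring.
- by rewrite mbr0l; apply/ffunP => i; rewrite !ffunE; ring.
Qed.

Lemma mbr_mJ_scalar L a b t : mbr L (mJ R a b) (ev R (inr (inr t))) = 0.
Proof.
apply: (mJ_ind (Q := fun a b x => mbr L x _ = 0)) => [p|{}a {}b x|{}a].
- by rewrite mbr_ev.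
- by rewrite mbrNl => ->; rewrite oppr0.
- exact: mbr0l.
Qed.

Variables (V : lmodType R) (br : V -> V -> V).
Hypothesis lie : is_lie_bracket br.

(** The basis of the model is pulled back along the isomorphism. The Lie axioms come from [br], so
    that [mbr] enters only through its values on basis vectors. *)
Lemma normal_form_of_iso L : iso_to_model d br L ->
  exists J P H D, @normal_form R d V br J P H D (PPJ L) (PPH L) (DHc L) (DPc L).
Proof.
move=> [f [flin [g fK gK] fbr]].
have glin k x y : g (k *: x + y) = k *: g x + g y.
  by apply: (can_inj fK); rewrite flin !gK.
have g0 : g 0 = 0.
  have := glin 1 0 0; rewrite !scale1r addr0 => e.
  by apply: (addrI (g 0)); rewrite -e addr0.
have gD x y : g (x + y) = g x + g y.
  by have := glin 1 x y; rewrite !scale1r.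
have gZ k x : g (k *: x) = k *: g x.
  by have := glin k x 0; rewrite g0 !addr0.
have gN x : g (- x) = - g x by rewrite -[- x]scaleN1r gZ scaleN1r.
have gbr x y : br (g x) (g y) = g (mbr L x y).
  by apply: (can_inj fK); rewrite gK fbr !gK.
exists (fun a b => g (mJ R a b)), (fun a => g (mP R a)), (g (mH R d)), (g (mD R d)).
split; first split=> //.
- by move=> a b; rewrite mJN gN.
- have combE : comb (lif_family (fun a b => g (mJ R a b)) (fun a => g (mP R a))
      (g (mH R d)) (g (mD R d))) =1 g.
    move=> c; have famE i : lif_family (fun a b => g (mJ R a b))
       (fun a => g (mP R a)) (g (mH R d)) (g (mD R d)) i = g (ev R i).
      case: i => [p|[a|[]]] //=.
      have [q [qE ->]] := mJ_lt (valP p).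
      by congr (g (ev R (inl _))); apply: val_inj; rewrite qE; case: (val p).
    rewrite /comb; under eq_bigr do rewrite famE -gZ.
    rewrite -(big_morph g gD g0); congr g; apply/ffunP => j.
    rewrite sum_ffunE (bigD1 j) //= !ffunE eqxx big1 ?addr0 => [|i /negPf ij].
      by rewrite /GRing.scale /= mulr1.
    by rewrite !ffunE eq_sym ij /GRing.scale /= mulr0.
  exists f => [c|x]; first by rewrite -[LHS]/(f (comb _ c)) combE gK.
  by rewrite -[LHS]/(comb _ (f x)) combE fK.
- by move=> a b c e; rewrite gbr mbr_mJ_mJ /JJbr !(gD, gN, gZ).
- split=> [a b c|a b]; first by rewrite gbr mbr_mJ_mP /JPbr !(gD, gN, gZ).
  by rewrite !gbr /mH /mD !mbr_mJ_scalar g0.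
- by move=> a b; rewrite gbr mbr_ev /= !(gD, gZ).
- by move=> a; rewrite gbr mbr_ev /= !(gD, gZ).
- by move=> a; rewrite gbr mbr_ev /= g0.
- by rewrite gbr mbr_ev /= gZ.
Qed.

(** The isomorphism is the coordinate map; bilinearity reduces its compatibility with brackets to
    pairs of basis vectors. *)
Lemma iso_of_normal_form L J P H D :
  @normal_form R d V br J P H D (PPJ L) (PPH L) (DHc L) (DPc L) ->
  iso_to_model d br L.
Proof.
move=> [[_ JN bas JJ [JP Jscal]] PP DP HP DH].
set fam := lif_family J P H D in bas.
have glin := combP fam.
have g0 : comb fam 0 = 0.
  by rewrite /comb big1 // => i _; rewrite ffunE scale0r.
have gD x y : comb fam (x + y) = comb fam x + comb fam y.
  by have := glin 1 x y; rewrite !scale1r.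
have gZ k x : comb fam (k *: x) = k *: comb fam x.
  by have := glin k x 0; rewrite g0 !addr0.
have gN x : comb fam (- x) = - comb fam x by rewrite -[- x]scaleN1r gZ scaleN1r.
have gJ a b : comb fam (mJ R a b) = J a b.
  apply: (mJ_ind (Q := fun a b x => comb fam x = J a b)) => [p|{}a {}b x|{}a].
  - by rewrite comb_ev.
  - by rewrite gN => ->; rewrite JN opprK.
  - by rewrite g0; apply/esym/eq_oppv_eq0/JN.
have gP a : comb fam (mP R a) = P a by rewrite comb_ev.
have gH : comb fam (mH R d) = H by rewrite comb_ev.
have gbb i j : comb fam (bb L i j) = br (fam i) (fam j).
  have JH a b : br (J a b) H = 0 by case: (Jscal a b).
  have JD a b : br (J a b) D = 0 by case: (Jscal a b).
  case: i j => [p|[a|[]]] [q|[b|[]]] /=;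
    rewrite /JJbr /JPbr ?(gD, gN, gZ, gJ, gP, gH, g0) ?JJ ?JP ?PP ?DP ?HP ?DH ?JH ?JD
      ?(brxx lie) //.
  - by rewrite (brC lie) JP.
  - by rewrite (brC lie) DP.
  - by rewrite (brC lie) HP oppr0.
  - by rewrite (brC lie) JD oppr0.
  - by rewrite (brC lie) JH oppr0.
  - by rewrite (brC lie) DH.
have gbr x y : comb fam (mbr L x y) = br (comb fam x) (comb fam y).
  rewrite (br_suml lie) /mbr (big_morph _ gD g0); apply: eq_bigr => i _.
  rewrite (br_sumr lie) (big_morph _ gD g0) scaler_sumr; apply: eq_bigr => j _.
  by rewrite gZ gbb scalerA.
case: bas => f gK fK; exists f; split.
- by move=> k x y; apply: (can_inj gK); rewrite fK [RHS]glin /comb !fK.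
- by exists (comb fam).
- by move=> x y; apply: (can_inj gK); rewrite fK [RHS]gbr /comb !fK.
Qed.

End Models.

(** * Rotation weights of the basis vectors *)

Definition index_support (d : nat) (i : Idx d) (c : 'I_d) : bool :=
  match i with
  | inl p => (c == (val p).1) || (c == (val p).2)
  | inr (inl a) => c == a
  | inr (inr _) => false
  end.

Section LifshitzAlgebra.
Variables (R : realType) (d : nat) (V : lmodType R) (br : V -> V -> V).
Variables (J : 'I_d -> 'I_d -> V) (P : 'I_d -> V) (H D : V).
Hypothesis lif : lifshitz_lie_algebra br J P H D.
Local Notation fam := (lif_family J P H D).

Lemma lifshitz_lie : is_lie_bracket br. Proof. by case: lif. Qed.
Let lie := lifshitz_lie.

Lemma JN a b : J a b = - J b a. Proof. by case: lif. Qed.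

Lemma Jdiag a : J a a = 0.
Proof.
exact: (eq_oppv_eq0 (JN a a)).
Qed.

Lemma lifshitz_JJ a b c e : br (J a b) (J c e) =
  delta R b c *: J a e - delta R a c *: J b e - delta R b e *: J a c + delta R a e *: J b c.
Proof. by case: lif. Qed.

Lemma lifshitz_JP a b c : br (J a b) (P c) = delta R b c *: P a - delta R a c *: P b.
Proof. by case: lif => _ _ _ _ []. Qed.

Lemma lifshitz_JH a b : br (J a b) H = 0.
Proof. by case: lif => _ _ _ _ [_ /(_ a b)[]]. Qed.

Lemma lifshitz_JD a b : br (J a b) D = 0.
Proof. by case: lif => _ _ _ _ [_ /(_ a b)[]]. Qed.

Lemma lifshitz_PJ a b c : br (P c) (J a b) = delta R a c *: P b - delta R b c *: P a.
Proof. by rewrite (brC lie) lifshitz_JP opprB. Qed.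

Lemma lifshitz_HJ a b : br H (J a b) = 0.
Proof. by rewrite (brC lie) lifshitz_JH oppr0. Qed.

Lemma lifshitz_DJ a b : br D (J a b) = 0.
Proof. by rewrite (brC lie) lifshitz_JD oppr0. Qed.

Lemma lifshitz_coordinates : exists co, coordinates fam co.
Proof. by case: lif => _ _ /basis_coordinates. Qed.

Variable co : V -> Idx d -> R.
Hypothesis bco : coordinates fam co.

(** Families that transform like P, and below like J. The brackets [T, P_c] with T invariant and
    [P_a, P_b] are of these kinds, so that computing one member determines the family. *)
Definition vector_family (X : 'I_d -> V) := forall a b c,
  br (J a b) (X c) = delta R b c *: X a - delta R a c *: X b.

Definition tensor_family (Y : 'I_d -> 'I_d -> V) :=
  (forall a b, Y a b = - Y b a) /\
  forall a b c e, br (J a b) (Y c e) =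
    delta R b c *: Y a e - delta R a c *: Y b e - delta R b e *: Y a c + delta R a e *: Y b c.

(** ad J_ab is a quarter turn in the plane of a and b and vanishes on the other axes. *)
Lemma ad_square_vector X a b c : vector_family X -> a != b ->
  br (J a b) (br (J a b) (X c)) = - (((a == c) (+) (b == c))%:R *: X c).
Proof.
move=> JX ab; have ba : b != a by rewrite eq_sym.
rewrite JX !(brE lie) !JX /delta !eqxx (negPf ab) (negPf ba).
have [?|ac] := eqVneq a c; have [?|bc] := eqVneq b c; subst;
rewrite ?eqxx /= in ab ba *; try by [];
rewrite ?(negPf ab) ?(negPf ba) /=;
apply: (co_inj bco) => i; rewrite ?(coE bco); ring.
Qed.

Lemma tensor_diag Y a : tensor_family Y -> Y a a = 0.
Proof.
move=> [YN _]; exact: (eq_oppv_eq0 (YN a a)).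
Qed.

(** J_ab commutes with Y_ce when {c, e} equals {a, b} or is disjoint from it; otherwise it makes a
    quarter turn on the shared index. *)
Lemma ad_square_tensor Y a b c e : tensor_family Y -> a != b -> c != e ->
  br (J a b) (br (J a b) (Y c e)) =
  - ((((a == c) || (a == e)) (+) ((b == c) || (b == e)))%:R *: Y c e).
Proof.
move=> tY ab ce; have [YN JY] := tY.
have ba : b != a by rewrite eq_sym.
have ec : e != c by rewrite eq_sym.
rewrite JY !(brE lie) !JY /delta !eqxx (negPf ab) (negPf ba).
have [?|ac] := eqVneq a c; have [?|ae] := eqVneq a e;
have [?|bc] := eqVneq b c; have [?|be] := eqVneq b e; subst;
rewrite ?eqxx /= in ab ba ce ec *; try by [];
rewrite ?(negPf ab) ?(negPf ba) ?(negPf ce) ?(negPf ec) /=;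
rewrite ?(tensor_diag _ tY);
apply: (co_inj bco) => i; rewrite ?(coE bco); try ring.
all: rewrite ?[Y b a]YN ?[Y c a]YN ?[Y e a]YN ?[Y e c]YN ?(coE bco); try ring.
all: rewrite ?[Y c b]YN ?[Y e b]YN ?(coE bco); ring.
Qed.

Lemma vector_family_P : vector_family P. Proof. exact: lifshitz_JP. Qed.

Lemma tensor_family_J : tensor_family J.
Proof. by split; [exact: JN | exact: lifshitz_JJ]. Qed.

Lemma ad_J_square a b i : a != b ->
  br (J a b) (br (J a b) (fam i)) =
  - ((index_support i a (+) index_support i b)%:R *: fam i).
Proof.
move=> ab; case: i => [[[c e] /= ce]|[c|[]]] /=.
- have {}ce : c != e by apply: contraTneq ce => ->; rewrite ltnn.
  by rewrite (ad_square_tensor tensor_family_J).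
- by rewrite (ad_square_vector _ vector_family_P).
- by rewrite lifshitz_JD (br0r lie) scale0r oppr0.
- by rewrite lifshitz_JH (br0r lie) scale0r oppr0.
Qed.

Lemma co_ad_J_square a b x i : a != b ->
  co (br (J a b) (br (J a b) x)) i =
  - ((index_support i a (+) index_support i b)%:R * co x i).
Proof.
move=> ab; rewrite -{1}(coK bco x) !(br_sumr lie) (co_sum bco).
rewrite (bigD1 i) //= ad_J_square // !(coE bco) (co_basis bco) eqxx.
rewrite big1 => [|j /negPf ji] /=; first by ring.
by rewrite ad_J_square // !(coE bco) (co_basis bco) eq_sym ji /=; ring.
Qed.

(* The operators (ad J_ab)^2 are simultaneously diagonal, and their eigenvalues
   determine the index set of a basis vector up to complementation. *)
Definition has_weight (S : 'I_d -> bool) x := forall a b, a != b ->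
  br (J a b) (br (J a b) x) = - ((S a (+) S b)%:R *: x).

(** The i-th coordinate of (ad J_ab)^2 x is computed in two ways. The squares only see whether a and
    b are separated by a set, hence the conclusion on pairs: the support of i is S or its
    complement. *)
Lemma weight_support S x i : has_weight S x -> co x i != 0 ->
  forall a b, (S a == S b) = (index_support i a == index_support i b).
Proof.
move=> wS xi a b; have [->|ab] := eqVneq a b; first by rewrite !eqxx.
have := co_ad_J_square x i ab; rewrite wS // !(coE bco) => /oppr_inj /(mulIf xi) /eqP.
by case: (S a) (S b) (index_support i a) (index_support i b) => [] [] [] [];
  rewrite //= ?oner_eq0 // eq_sym oner_eq0.
Qed.

Lemma expand_support x (s : seq (Idx d)) : uniq s ->
  (forall i, co x i != 0 -> i \in s) -> x = \sum_(i <- s) co x i *: fam i.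
Proof.
move=> us sup; rewrite -{1}(coK bco x) (bigID (mem s)) /=.
rewrite [X in _ + X]big1 ?addr0 => [|i]; last first.
  by apply: contraNeq => xi; apply: sup; apply: contraNneq xi => ->; rewrite scale0r.
by rewrite (big_uniq _ us).
Qed.

(** The basis contains J_uv only for u < v; the scalar absorbs the sign when a and b come in the
    other order. *)
Lemma J_index a b : a != b -> exists p : Jidx d, [/\ exists e : R, fam (inl p) = e *: J a b,
  index_support (inl p) a, index_support (inl p) b &
  forall q : Jidx d, index_support (inl q) a -> index_support (inl q) b -> q = p].
Proof.
have main (u v : 'I_d) : (val u < val v)%N -> exists p : Jidx d,
  [/\ fam (inl p) = J u v, index_support (inl p) u, index_support (inl p) v &
  forall q : Jidx d, index_support (inl q) u -> index_support (inl q) v -> q = p].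
  move=> uv; exists (exist _ (u, v) uv); rewrite /= !eqxx orbT; split=> //.
  case=> -[u' v'] /= uv' /orP[]/eqP Eu /orP[]/eqP Ev; apply: val_inj => /=; subst=> //.
  - by rewrite ltnn in uv.
  - by move: (ltn_trans uv uv'); rewrite ltnn.
  - by rewrite ltnn in uv.
move=> ab; case: (ltngtP a b) => [lt|lt|/val_inj e]; last by rewrite e eqxx in ab.
  have [p [E pa pb u]] := main _ _ lt; exists p; split=> //.
  by exists 1; rewrite scale1r.
have [p [E pb pa u]] := main _ _ lt; exists p; split=> //; last by move=> q ? ?; apply: u.
by exists (-1); rewrite E scaleN1r JN.
Qed.

Lemma co_P_P a c : co (P a) (inr (inl c)) = (c == a)%:R.
Proof. exact: (co_basis bco (inr (inl a)) (inr (inl c))). Qed.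

Lemma co_P_scalar a t : co (P a) (inr (inr t)) = 0.
Proof. exact: (co_basis bco (inr (inl a)) (inr (inr t))). Qed.

Lemma co_H i : co H i = (i == inr (inr false))%:R.
Proof. exact: (co_basis bco (inr (inr false))). Qed.

Lemma co_D i : co D i = (i == inr (inr true))%:R.
Proof. exact: (co_basis bco (inr (inr true))). Qed.

Lemma co_J_other a b x : co (J a b) (inr x) = 0.
Proof.
have [->|ab] := eqVneq a b; first by rewrite Jdiag (co0 bco).
have [q [[k qE] _ _ _]] := J_index ab.
have k0 : k != 0.
  by apply: contraTneq (basis_neq0 bco (inl q)) => k0; rewrite qE k0 scale0r eqxx.
by apply: (mulfI k0); rewrite -(coZ bco) -qE (co_basis bco) mulr0.
Qed.

Lemma weight_vector X c : vector_family X -> has_weight (fun a => a == c) (X c).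
Proof. by move=> vX a b ab; exact: ad_square_vector. Qed.

Lemma weight_tensor Y c e : tensor_family Y -> c != e ->
  has_weight (fun a => (a == c) || (a == e)) (Y c e).
Proof. by move=> tY ce a b ab; exact: ad_square_tensor. Qed.

Lemma weight_scalar x : (forall a b, br (J a b) x = 0) -> has_weight (fun=> false) x.
Proof. by move=> Jx a b _; rewrite Jx (br0r lie) scale0r oppr0. Qed.

(** [J_ca, X_a] = X_c for c distinct from a. Applied to a difference X - k P, this spreads
    proportionality from one index to all. *)
Lemma vector_family_eq0 X a : vector_family X -> X a = 0 -> forall c, X c = 0.
Proof.
move=> vX Xa c; have [->//|ca] := eqVneq c a.
have := vX c a a; rewrite Xa (br0r lie) /delta eqxx scale1r scaler0 subr0.
by move=> ->.
Qed.

(** Rotations carry one pair of distinct indices to any other, moving one index at a time. *)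
Lemma tensor_family_eq0 Y a b : tensor_family Y -> a != b -> Y a b = 0 ->
  forall c e, Y c e = 0.
Proof.
move=> tY ab Yab; have [YN JY] := tY.
have Yb c : Y c b = 0.
  have [->//|ca] := eqVneq c a.
  have [->|cb] := eqVneq c b; first exact: tensor_diag.
  have := JY c a a b; rewrite Yab (br0r lie) /delta eqxx (negPf ca) (negPf ab) (negPf cb).
  by rewrite !scale0r scale1r subr0 addr0 subr0 => <-.
move=> c e; have [->|ce] := eqVneq c e; first exact: tensor_diag.
have [->|cb] := eqVneq c b; first by rewrite YN Yb oppr0.
have [->//|eb] := eqVneq e b.
have := JY e b c b; rewrite Yb (br0r lie) /delta eqxx (negPf eb).
rewrite [b == c]eq_sym [e == c]eq_sym (negPf cb) (negPf ce).
by rewrite !scale0r scale1r subrr addr0 sub0r -YN => <-.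
Qed.

Lemma vector_familyB X X' k : vector_family X -> vector_family X' ->
  vector_family (fun c => X c - k *: X' c).
Proof.
move=> vX vX' a b c; rewrite !(brE lie) vX vX'.
by apply: (co_inj bco) => i; rewrite !(coE bco); ring.
Qed.

Lemma tensor_familyB Y Y' k : tensor_family Y -> tensor_family Y' ->
  tensor_family (fun a b => Y a b - k *: Y' a b).
Proof.
move=> [YN JY] [YN' JY']; split=> [a b|a b c e].
  by rewrite YN (YN' a) scalerN opprD.
rewrite !(brE lie) JY JY'.
by apply: (co_inj bco) => i; rewrite !(coE bco); ring.
Qed.

Lemma vector_family_ad T : (forall a b, br (J a b) T = 0) ->
  vector_family (fun c => br T (P c)).
Proof.
move=> JT a b c; rewrite (br_derivation lie) JT (br0l lie) add0r lifshitz_JP.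
by rewrite !(brE lie).
Qed.

Lemma tensor_family_PP : tensor_family (fun a b => br (P a) (P b)).
Proof.
split=> [a b|a b c e]; first exact: (brC lie).
rewrite (br_derivation lie) !lifshitz_JP !(brE lie) [br (P c) (P a)](brC lie).
rewrite [br (P c) (P b)](brC lie).
by apply: (co_inj bco) => i; rewrite !(coE bco); ring.
Qed.

End LifshitzAlgebra.

(** * Changes of basis *)

Section SpannedFamily.
Variables (R : realType) (d : nat) (V : lmodType R).
Variables (J : 'I_d -> 'I_d -> V) (P : 'I_d -> V) (H D : V).
Local Notation fam := (lif_family J P H D).

Lemma spanned_J a b : (forall a b, J a b = - J b a) -> spanned fam (J a b).
Proof.
move=> JN'; case: (ltngtP a b) => [lt|lt|/val_inj ->].
- exact: (spanned_basis fam (inl (exist _ (a, b) lt))).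
- rewrite JN'; apply: spannedN.
  exact: (spanned_basis fam (inl (exist _ (b, a) lt))).
- have -> : J b b = 0; last exact: spanned0.
  exact: (eq_oppv_eq0 (JN' b b)).
Qed.

Lemma spanned_P a : spanned fam (P a).
Proof. exact: (spanned_basis fam (inr (inl a))). Qed.

Lemma spanned_H : spanned fam H.
Proof. exact: (spanned_basis fam (inr (inr false))). Qed.

Lemma spanned_D : spanned fam D.
Proof. exact: (spanned_basis fam (inr (inr true))). Qed.
End SpannedFamily.

Section Reduction.
Variables (R : realType) (d : nat) (V : lmodType R) (br : V -> V -> V).
Variables (J : 'I_d -> 'I_d -> V) (P : 'I_d -> V) (H D : V).
Hypothesis lif : lifshitz_lie_algebra br J P H D.
Local Notation fam := (lif_family J P H D).
Let lie := lifshitz_lie lif.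

(** The new family has as many members as the old one, so expressing the old generators in it
    already makes it a basis. *)
Lemma lifshitz_rebase (J' : 'I_d -> 'I_d -> V) (P' : 'I_d -> V) H' D' :
  (forall a b, J' a b = - J' b a) ->
  (forall a b c e, br (J' a b) (J' c e) =
     delta R b c *: J' a e - delta R a c *: J' b e - delta R b e *: J' a c
     + delta R a e *: J' b c) ->
  (forall a b c, br (J' a b) (P' c) = delta R b c *: P' a - delta R a c *: P' b) ->
  (forall a b, br (J' a b) H' = 0) -> (forall a b, br (J' a b) D' = 0) ->
  (forall a b, spanned (lif_family J' P' H' D') (J a b)) ->
  (forall a, spanned (lif_family J' P' H' D') (P a)) ->
  spanned (lif_family J' P' H' D') H -> spanned (lif_family J' P' H' D') D ->
  lifshitz_lie_algebra br J' P' H' D'.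
Proof.
move=> J'N JJ' JP' JH' JD' sJ sP sH sD; split=> //.
case: lif => _ _ bas _ _; apply: (spanning_family_basis bas) => -[p|[a|[]]] //=.
Qed.

Lemma lifshitz_rebase_scalars x y u w : x * w - y * u != 0 ->
  lifshitz_lie_algebra br J P (x *: H + y *: D) (u *: H + w *: D).
Proof.
move=> det0; have [co bco] := lifshitz_coordinates lif.
set H' := _ + _; set D' := _ + _; set n := x * w - y * u.
apply: lifshitz_rebase.
- exact: (JN lif).
- exact: (lifshitz_JJ lif).
- exact: (lifshitz_JP lif).
- by move=> a b; rewrite !(brE lie) (lifshitz_JH lif) (lifshitz_JD lif) !scaler0 addr0.
- by move=> a b; rewrite !(brE lie) (lifshitz_JH lif) (lifshitz_JD lif) !scaler0 addr0.
- by move=> a b; apply/spanned_J/(JN lif).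
- by move=> a; apply: spanned_P.
- have -> : H = (w / n) *: H' + (- y / n) *: D'.
    by apply: (co_inj bco) => i; rewrite !(coE bco) /n; field.
  by apply: spannedD; apply: spannedZ; [apply: spanned_H | apply: spanned_D].
- have -> : D = (- u / n) *: H' + (x / n) *: D'.
    by apply: (co_inj bco) => i; rewrite !(coE bco) /n; field.
  by apply: spannedD; apply: spannedZ; [apply: spanned_H | apply: spanned_D].
Qed.

Lemma lifshitz_rebase_P k : k != 0 ->
  lifshitz_lie_algebra br J (fun a => k *: P a) H D.
Proof.
move=> k0; apply: lifshitz_rebase.
- exact: (JN lif).
- exact: (lifshitz_JJ lif).
- move=> a b c; rewrite !(brE lie) (lifshitz_JP lif) scalerBr.
  by rewrite !scalerA [k * _]mulrC [k * _]mulrC.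
- exact: (lifshitz_JH lif).
- exact: (lifshitz_JD lif).
- by move=> a b; apply/spanned_J/(JN lif).
- move=> a; rewrite -[P a](scalerK k0); apply: spannedZ.
  exact: (spanned_P J (fun a => k *: P a) H D a).
- exact: spanned_H.
- exact: spanned_D.
Qed.

(** * Brackets allowed by rotations in dimension at least three *)

Section HighDimension.
Variables a b c : 'I_d.
Hypotheses (ab : a != b) (ac : a != c) (bc : b != c).
Let ba : b != a. Proof. by rewrite eq_sym. Qed.
Let ca : c != a. Proof. by rewrite eq_sym. Qed.
Let cb : c != b. Proof. by rewrite eq_sym. Qed.
Let dE := (negPf ab, negPf ac, negPf bc, negPf ba, negPf ca, negPf cb).

(** The support of a component is empty or full. With three distinct indices available a full
    support is impossible, since supports have at most two elements. *)
Lemma invariant_scalar x : (forall u v, br (J u v) x = 0) ->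
  exists h t, x = h *: H + t *: D.
Proof.
move=> Jx; have [co bco] := lifshitz_coordinates lif.
exists (co x (inr (inr false))), (co x (inr (inr true))).
rewrite {1}(expand_support bco (x := x) (s := [:: inr (inr false); inr (inr true)])) //.
  by rewrite big_cons big_seq1.
move=> i xi; have W := weight_support lif bco (weight_scalar lif Jx) xi.
case: i xi W => [[[u v] uv]|[f|[]]] xi W //; exfalso.
- have A w : index_support (inl (exist _ (u, v) uv) : Idx d) w.
    by have := W u w; rewrite /= !eqxx => /esym/eqP <-.
  move: (A a) (A b) (A c) => /= /orP[]/eqP Ea /orP[]/eqP Eb /orP[]/eqP Ec;
    by move: ab ac bc; rewrite ?Ea ?Eb ?Ec eqxx.
- have := W f a; have := W f b; rewrite /= !eqxx => /esym/eqP/esym/eqP Ea /esym/eqP/esym/eqP Eb.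
  by move: ab; rewrite Ea Eb eqxx.
Qed.

(** The complement of {a} is the support of J_bc when d = 3, so a J component is conceivable; the
    Jacobi identity excludes it, given that [P, P] has no P component. *)
Lemma scalar_action l T : (forall u v, br (P u) (P v) = l *: J u v) ->
  (forall u v, br (J u v) T = 0) -> exists k, forall u, br T (P u) = k *: P u.
Proof.
move=> PP JT; have [co bco] := lifshitz_coordinates lif.
have vX := vector_family_ad lif JT; have wX := weight_vector lif bco a vX.
have [p [[e pE] pb pc pu]] := J_index lif bc.
have [al [be Xa]] : exists al be, br T (P a) = al *: P a + be *: J b c.
  exists (co (br T (P a)) (inr (inl a))), (co (br T (P a)) (inl p) * e).
  rewrite {1}(expand_support bco (x := br T (P a)) (s := [:: inr (inl a); inl p])) //.
    by rewrite big_cons big_seq1 pE scalerA.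
  move=> i xi; have W := weight_support lif bco wX xi.
  case: i xi W => [[[u v] uv]|[f|t]] xi W.
  + have uNv : u != v by apply/eqP => E; move: (uv); rewrite /= E ltnn.
    have Wuv := W u v; rewrite /= !eqxx orbT eqxx in Wuv.
    have uNa : u != a.
      apply: contraTneq (Wuv) => ua; rewrite ua eqxx -ua.
      by rewrite [v == u]eq_sym (negPf uNv).
    have A w : w != a -> (w == u) || (w == v).
      by move=> wa; have := W u w; rewrite /= (negPf uNa) (negPf wa) !eqxx /= => /esym/eqP <-.
    have -> : exist _ (u, v) uv = p :> Jidx d; last by rewrite !inE eqxx orbT.
    by apply: pu; apply: A.
  + have := W b c; have := W a b; rewrite /= !dE !eqxx !inE.
    have [<-|fa] := eqVneq a f; first by rewrite !eqxx.
    have [bf|bf] := eqVneq b f; last by [].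
    by rewrite -bf dE.
  + by have := W a b; rewrite /= dE eqxx.
(* Rotating the formula for [T, P_a] by J_ba. *)
have Xb : br T (P b) = al *: P b - be *: J a c.
  have <- : br (J b a) (br T (P a)) = br T (P b).
    by rewrite vX /delta eqxx dE scale1r scale0r subr0.
  rewrite Xa !(brE lie) (lifshitz_JP lif) (lifshitz_JJ lif) /delta !eqxx !dE /=.
  by apply: (co_inj bco) => i; rewrite !(coE bco); ring.
(* ad T annihilates [P_a, P_b] = l J_ab, while the P_c component of the Leibniz expansion is -2
   [be]. *)
have be0 : be = 0.
  have := br_derivation lie T (P a) (P b).
  rewrite PP Xa Xb !(brE lie) PP (lifshitz_PJ lif) (lifshitz_JP lif) [br T _](brC lie) JT.
  rewrite /delta !eqxx !dE /= => /(congr1 (co^~ (inr (inl c)))).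
  rewrite !(coE bco) (co_J_other lif bco) !(co_P_P bco) !eqxx !dE /=; lra.
exists al => u; apply/eqP; rewrite -subr_eq0; apply/eqP.
have vXP := vector_familyB lif bco al vX (vector_family_P lif).
apply: (vector_family_eq0 lif vXP (a := a)).
by rewrite Xa be0 scale0r addr0 subrr.
Qed.

Lemma PP_of_one_pair l : br (P a) (P b) = l *: J a b ->
  forall u v, br (P u) (P v) = l *: J u v.
Proof.
move=> E u v; have [co bco] := lifshitz_coordinates lif.
apply/eqP; rewrite -subr_eq0; apply/eqP.
have tY := tensor_familyB lif bco l (tensor_family_PP lif bco) (tensor_family_J lif).
by apply: (tensor_family_eq0 lif tY ab); rewrite E subrr.
Qed.
End HighDimension.
End Reduction.

Section MomentumBrackets.
Variables (R : realType) (d : nat) (V : lmodType R) (br : V -> V -> V).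
Variables (J : 'I_d -> 'I_d -> V) (P : 'I_d -> V) (H D : V).
Hypothesis lif : lifshitz_lie_algebra br J P H D.
Local Notation fam := (lif_family J P H D).
Let lie := lifshitz_lie lif.

(** In dimension four {c, e} is the complement of {a, b}, so the weight allows J_ce besides J_ab. A
    single P_f cannot separate {a, b} from both c and e. *)
Lemma PP_dim_ge4 (a b c e : 'I_d) : uniq [:: a; b; c; e] ->
  exists l, forall u v, br (P u) (P v) = l *: J u v.
Proof.
rewrite /= !inE !negb_or => /and4P[/and3P[ab ac ae] /andP[bc be] ce _].
have [co bco] := lifshitz_coordinates lif.
have dE := (negPf ab, negPf ac, negPf ae, negPf bc, negPf be, negPf ce).
have ba := negPf ab; have ca := negPf ac; have ea := negPf ae.
have cb := negPf bc; have eb := negPf be; have ec := negPf ce.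
rewrite eq_sym in ba; rewrite eq_sym in ca; rewrite eq_sym in ea.
rewrite eq_sym in cb; rewrite eq_sym in eb; rewrite eq_sym in ec.
have {}dE := (dE, ba, ca, ea, cb, eb, ec).
have tY := tensor_family_PP lif bco; have wY := weight_tensor lif bco tY ab.
have [p [[k pE] pa pb pu]] := J_index lif ab.
have [q [[k' qE] qc qe qu]] := J_index lif ce.
have pq : p != q.
  apply/eqP => E; move: pa pb qc; rewrite -E /= => /orP[]/eqP Ea /orP[]/eqP Eb /orP[]/eqP Ec;
    by move: ab ac bc; rewrite ?Ea ?Eb ?Ec eqxx.
have [l [mu Yab]] : exists l mu, br (P a) (P b) = l *: J a b + mu *: J c e.
  exists (co (br (P a) (P b)) (inl p) * k), (co (br (P a) (P b)) (inl q) * k').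
  rewrite {1}(expand_support bco (x := br (P a) (P b)) (s := [:: inl p; inl q])) //.
  - by rewrite big_cons big_seq1 pE qE !scalerA.
  - by rewrite /= inE andbT.
  move=> i xi; have W := weight_support lif bco wY xi.
  case: i xi W => [[[u v] uv]|[f|t]] xi W.
  + have uNv : u != v by apply/eqP => E; move: (uv); rewrite /= E ltnn.
    have Wuv := W u v; rewrite /= !eqxx orbT eqxx in Wuv.
    have [Su|Su] := boolP ((u == a) || (u == b)).
      have Sv : (v == a) || (v == b) by move: Wuv; rewrite Su => /eqP <-.
      have -> : exist _ (u, v) uv = p :> Jidx d; last by rewrite !inE eqxx.
      apply: pu => /=; move: Su Sv uNv.
        by move=> /orP[]/eqP-> /orP[]/eqP->; rewrite !eqxx ?orbT.
      by move=> /orP[]/eqP-> /orP[]/eqP->; rewrite !eqxx ?orbT.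
    have A w : ~~ ((w == a) || (w == b)) -> (w == u) || (w == v).
      by move=> wa; have := W u w; rewrite /= (negPf Su) (negPf wa) !eqxx /= => /esym/eqP <-.
    have -> : exist _ (u, v) uv = q :> Jidx d; last by rewrite !inE eqxx orbT.
    by apply: qu; apply: A; rewrite !dE.
  + have Wab := W a b; have Wce := W c e; have Wac := W a c.
    rewrite /= !eqxx !dE /= in Wab Wce Wac.
    exfalso; move: Wab Wce Wac.
    have [<-|_] := eqVneq a f; first by rewrite !dE.
    have [<-//|_] := eqVneq b f.
    have [<-|_] := eqVneq c f; first by rewrite !dE.
    by [].
  + by have := W a c; rewrite /= !dE eqxx.
have [_ JY] := tY.
have Ycb : br (P c) (P b) = l *: J c b - mu *: J a e.
  have <- : br (J c a) (br (P a) (P b)) = br (P c) (P b).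
    by rewrite JY /delta eqxx !dE scale1r !scale0r !subr0 addr0.
  rewrite Yab !(brE lie) !(lifshitz_JJ lif) /delta !eqxx !dE /=.
  by apply: (co_inj bco) => i; rewrite !(coE bco); ring.
have Yac : br (P a) (P c) = l *: J a c - mu *: J b e.
  have <- : br (J c b) (br (P a) (P b)) = br (P a) (P c).
    rewrite JY /delta eqxx !dE !scale0r scale1r subrr sub0r addr0.
    by rewrite -(brC lie).
  rewrite Yab !(brE lie) !(lifshitz_JJ lif) /delta !eqxx !dE /= [J c a](JN lif).
  by apply: (co_inj bco) => i; rewrite !(coE bco); ring.
(* The P_e component of the Jacobi identity for P_a, P_b, P_c reads [mu = - 2 mu]. *)
have mu0 : mu = 0.
  have := br_derivation lie (P a) (P b) (P c).
  rewrite [br (P b) (P c)](brC lie) Ycb Yab Yac !(brE lie).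
  rewrite !(lifshitz_PJ lif) !(lifshitz_JP lif) /delta !eqxx !dE /=.
  move=> /(congr1 (co^~ (inr (inl e)))).
  rewrite !(coE bco) !(co_P_P bco) !eqxx !dE /=; lra.
exists l; apply: (PP_of_one_pair lif ab).
by rewrite Yab mu0 scale0r addr0.
Qed.
End MomentumBrackets.

Section DimensionThree.
Variables (R : realType) (d : nat) (V : lmodType R) (br : V -> V -> V).
Variables (J : 'I_d -> 'I_d -> V) (P : 'I_d -> V) (H D : V).
Hypothesis lif : lifshitz_lie_algebra br J P H D.
Local Notation fam := (lif_family J P H D).
Let lie := lifshitz_lie lif.

(* In dimension three, [P_a, P_b] may have a P_c component; it is absorbed by
   shifting P along the Hodge dual of J, which is again a vector. *)
Lemma PP_dim3 (a b c : 'I_d) : uniq [:: a; b; c] -> (forall x, x \in [:: a; b; c]) ->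
  exists P' l, lifshitz_lie_algebra br J P' H D /\
               forall u v, br (P' u) (P' v) = l *: J u v.
Proof.
rewrite /= !inE !negb_or => /and3P[/andP[ab ac] bc _] cov.
have [co bco] := lifshitz_coordinates lif.
have dE := (negPf ab, negPf ac, negPf bc).
have ba := negPf ab; have ca := negPf ac; have cb := negPf bc.
rewrite eq_sym in ba; rewrite eq_sym in ca; rewrite eq_sym in cb.
have {}dE := (dE, ba, ca, cb).
have cov3 x : [\/ x = a, x = b | x = c].
  by have := cov x; rewrite !inE => /or3P[]/eqP->; [constructor 1|constructor 2|constructor 3].
have tY := tensor_family_PP lif bco; have wY := weight_tensor lif bco tY ab.
have [p [[k pE] pa pb pu]] := J_index lif ab.
have [l [mu Yab]] : exists l mu, br (P a) (P b) = l *: J a b + mu *: P c.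
  exists (co (br (P a) (P b)) (inl p) * k), (co (br (P a) (P b)) (inr (inl c))).
  rewrite {1}(expand_support bco (x := br (P a) (P b)) (s := [:: inl p; inr (inl c)])) //.
    by rewrite big_cons big_seq1 pE !scalerA.
  move=> i xi; have W := weight_support lif bco wY xi.
  case: i xi W => [[[u v] uv]|[f|t]] xi W.
  + have uNv : u != v by apply/eqP => E; move: (uv); rewrite /= E ltnn.
    have Wuv := W u v; rewrite /= !eqxx orbT eqxx in Wuv.
    have [Su|Su] := boolP ((u == a) || (u == b)).
      have Sv : (v == a) || (v == b) by move: Wuv; rewrite Su => /eqP <-.
      have -> : exist _ (u, v) uv = p :> Jidx d; last by rewrite !inE eqxx.
      apply: pu => /=; move: Su Sv uNv.
        by move=> /orP[]/eqP-> /orP[]/eqP->; rewrite !eqxx ?orbT.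
      by move=> /orP[]/eqP-> /orP[]/eqP->; rewrite !eqxx ?orbT.
    exfalso; move: Wuv uNv; rewrite (negPf Su); move: Su.
    by case: (cov3 u) => ->; case: (cov3 v) => ->; rewrite ?eqxx ?orbT.
  + have Wab := W a b; have Wac := W a c; rewrite /= !eqxx !dE /= in Wab Wac.
    move: Wab Wac; case: (cov3 f) => ->; rewrite !dE !eqxx ?inE ?eqxx ?orbT //.
  + by have := W a c; rewrite /= !dE eqxx.
(* The Hodge dual of J; it is a vector only because a, b, c are all the indices. *)
pose Q f := if f == a then J b c else if f == b then J c a else J a b.
have [Qa Qb Qc] : [/\ Q a = J b c, Q b = J c a & Q c = J a b].
  by rewrite /Q !eqxx !dE.
have [Jba Jca Jcb] : [/\ J b a = - J a b, J c a = - J a c & J c b = - J b c].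
  by split; exact: (JN lif).
have vQ : vector_family br J Q.
  move=> u v f; case: (cov3 u) => ->; case: (cov3 v) => ->; case: (cov3 f) => ->;
  rewrite ?Qa ?Qb ?Qc !(lifshitz_JJ lif) /delta ?eqxx ?dE ?(Jdiag lif) ?Jba ?Jca ?Jcb /=;
  apply: (co_inj bco) => i; rewrite !(coE bco); ring.
(* The mixed terms [P_a, Q_b] + [Q_a, P_b] equal -2 P_c, so half of [mu] cancels the P_c component.
   Since [J_bc, J_ca] = - J_ab, the quadratic term changes [l] to [l - k' ^+ 2]. *)
pose k' := mu / 2%:R; pose P' f := P f - (- k') *: Q f.
have vP' : vector_family br J P'.
  exact: (vector_familyB lif bco _ (vector_family_P lif) vQ).
have lif' : lifshitz_lie_algebra br J P' H D.
  have sJ u v : spanned (lif_family J P' H D) (J u v) by apply/spanned_J/(JN lif).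
  apply: (lifshitz_rebase lif) => //.
  - exact: (JN lif).
  - exact: (lifshitz_JJ lif).
  - exact: (lifshitz_JH lif).
  - exact: (lifshitz_JD lif).
  - move=> u; have -> : P u = P' u + (- k') *: Q u by rewrite /P' subrK.
    apply: spannedD; first exact: spanned_P.
    by apply: spannedZ; rewrite /Q; case: ifP => _ //; case: ifP.
  - exact: spanned_H.
  - exact: spanned_D.
exists P', (l - k' ^+ 2); split=> //.
apply: (PP_of_one_pair lif' ab).
rewrite /P' Qa Qb !(brE lie) Yab !(lifshitz_PJ lif) !(lifshitz_JP lif) !(lifshitz_JJ lif).
rewrite /delta ?eqxx ?dE ?(Jdiag lif) ?Jba ?Jca ?Jcb /=.
by apply: (co_inj bco) => i; rewrite !(coE bco) /k'; field.
Qed.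
End DimensionThree.

(** * Dimension two, where rotations commute *)

Section DimensionTwo.
Variables (R : realType) (V : lmodType R) (br : V -> V -> V).

Lemma ord2_cases (u : 'I_2) : u = ord0 \/ u = ord_max.
Proof. by case: u => [[|[|//]] lt]; [left|right]; apply: val_inj. Qed.

Lemma antisym_dim2 (Y : 'I_2 -> 'I_2 -> V) u v : (forall u v, Y u v = - Y v u) ->
  Y u v = eps2 R u v *: Y ord0 ord_max.
Proof.
move=> YN; have Yd w : Y w w = 0.
  exact: (eq_oppv_eq0 (YN w w)).
case: (ord2_cases u) => ->; case: (ord2_cases v) => ->; rewrite /eps2 /= ?Yd.
- by rewrite subrr scale0r.
- by rewrite subr0 scale1r.
- by rewrite sub0r scaleN1r YN.
- by rewrite subrr scale0r.
Qed.

Variables (J : 'I_2 -> 'I_2 -> V) (P : 'I_2 -> V) (H D : V).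
Hypothesis lif : lifshitz_lie_algebra br J P H D.
Local Notation fam := (lif_family J P H D).
Let lie := lifshitz_lie lif.
Local Notation a := (ord0 : 'I_2).
Local Notation b := (ord_max : 'I_2).

Lemma JJ_dim2 u v x y : br (J u v) (J x y) = 0.
Proof.
rewrite (antisym_dim2 u v (JN lif)) (antisym_dim2 x y (JN lif)).
by rewrite !(brE lie) (brxx lie) !scaler0.
Qed.

(** The full index set is now the support of J_01, so the weight of an invariant also allows the J
    direction. *)
Lemma invariant_dim2 x : has_weight br J (fun=> false) x ->
  exists l h t, x = l *: J a b + h *: H + t *: D.
Proof.
move=> wx; have [co bco] := lifshitz_coordinates lif.
have [p [[k pE] pa pb pu]] := J_index lif (isT : a != b).
exists (co x (inl p) * k), (co x (inr (inr false))), (co x (inr (inr true))).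
rewrite {1}(expand_support bco (x := x)
  (s := [:: inl p; inr (inr false); inr (inr true)])) //.
  by rewrite 2!big_cons big_seq1 pE scalerA addrA.
move=> i xi; have W := weight_support lif bco wx xi.
case: i xi W => [[[u v] uv]|[f|[]]] xi W //.
- have -> : exist _ (u, v) uv = p :> Jidx 2; last by rewrite !inE eqxx.
  have A w : (w == u) || (w == v).
    by have := W u w; rewrite /= !eqxx => /esym/eqP <-.
  by apply: pu; apply: A.
- by exfalso; have := W a b; case: (ord2_cases f) => ->.
Qed.

(* [D, P_0] may have a P_1 component; it is absorbed by shifting D along J. *)
Lemma scalar_action_dim2 T : (forall u v, br (J u v) T = 0) ->
  exists be k, forall u, br (T + be *: J a b) (P u) = k *: P u.
Proof.
move=> JT; have [co bco] := lifshitz_coordinates lif.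
have vX := vector_family_ad lif JT; have wX := weight_vector lif bco a vX.
have [k [be Xa]] : exists k be, br T (P a) = k *: P a + be *: P b.
  exists (co (br T (P a)) (inr (inl a))), (co (br T (P a)) (inr (inl b))).
  rewrite {1}(expand_support bco (x := br T (P a)) (s := [:: inr (inl a); inr (inl b)])) //.
    by rewrite big_cons big_seq1.
  move=> i xi; have W := weight_support lif bco wX xi.
  case: i xi W => [[[u v] uv]|[f|t]] xi W.
  - exfalso; have := W u v; rewrite /= !eqxx orbT eqxx; move: (uv).
    by case: (ord2_cases u) => ->; case: (ord2_cases v) => ->.
  - by case: (ord2_cases f) => ->.
  - by have := W a b.
exists be, k => u; apply/eqP; rewrite -subr_eq0; apply/eqP.
have JT' x y : br (J x y) (T + be *: J a b) = 0.
  by rewrite !(brE lie) JT JJ_dim2 scaler0 addr0.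
have vX' := vector_familyB lif bco k (vector_family_ad lif JT') (vector_family_P lif).
apply: (vector_family_eq0 lif vX' (a := a)).
rewrite !(brE lie) Xa (lifshitz_JP lif) /delta eqxx /=.
by apply: (co_inj bco) => i; rewrite !(coE bco); ring.
Qed.

End DimensionTwo.

(** What rotations leave free once H and D act on P by scalars. The last clause confines the epsilon
    term to dimension two. *)
Definition prenormal_form (R : realType) (d : nat) (V : lmodType R) (br : V -> V -> V)
  (J : 'I_d -> 'I_d -> V) (P : 'I_d -> V) (H D : V) (l mu nu al ga b c : R) : Prop :=
  [/\ lifshitz_lie_algebra br J P H D,
      forall u v, br (P u) (P v) = l *: J u v + eps2 R u v *: (mu *: H + nu *: D),
      forall u, br D (P u) = al *: P u,
      forall u, br H (P u) = ga *: P u &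
      br D H = b *: H + c *: D] /\
  (d != 2%N -> mu = 0 /\ nu = 0).

(** * Existence of a normal form *)

Section Prenormal.
Variables (R : realType) (d : nat) (V : lmodType R) (br : V -> V -> V).
Implicit Types (J : 'I_d -> 'I_d -> V) (P : 'I_d -> V) (H D : V).

Lemma prenormal_dim_ge3 (a b c : 'I_d) J P H D l : uniq [:: a; b; c] ->
  lifshitz_lie_algebra br J P H D -> (forall u v, br (P u) (P v) = l *: J u v) ->
  exists al ga be ce, prenormal_form br J P H D l 0 0 al ga be ce.
Proof.
rewrite /= !inE !negb_or => /and3P[/andP[ab ac] bc _] lif PP.
have lie := lifshitz_lie lif.
have [al alE] := scalar_action lif ab ac bc PP (lifshitz_JD lif).
have [ga gaE] := scalar_action lif ab ac bc PP (lifshitz_JH lif).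
have JDH u v : br (J u v) (br D H) = 0.
  by rewrite (br_derivation lie) (lifshitz_JD lif) (lifshitz_JH lif) !(brE lie) addr0.
have [be [ce DH]] := invariant_scalar lif ab ac bc JDH.
exists al, ga, be, ce; split=> //; split=> // u v.
by rewrite PP !scale0r addr0 scaler0 addr0.
Qed.
End Prenormal.

Lemma prenormal_dim2 (R : realType) (V : lmodType R) (br : V -> V -> V)
  (J : 'I_2 -> 'I_2 -> V) (P : 'I_2 -> V) (H D : V) :
  lifshitz_lie_algebra br J P H D ->
  exists H' D' l mu nu al ga be ce, prenormal_form br J P H' D' l mu nu al ga be ce.
Proof.
move=> lif; have lie := lifshitz_lie lif.
have [x [al alE]] := scalar_action_dim2 lif (lifshitz_JD lif).
have [y [ga gaE]] := scalar_action_dim2 lif (lifshitz_JH lif).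
set a : 'I_2 := ord0; set b : 'I_2 := ord_max.
set D' := D + _ in alE; set H' := H + _ in gaE.
have lif' : lifshitz_lie_algebra br J P H' D'.
  have sJ u v : spanned (lif_family J P H' D') (J u v) by apply/spanned_J/(JN lif).
  apply: (lifshitz_rebase lif) => //.
  - exact: (JN lif).
  - exact: (lifshitz_JJ lif).
  - exact: (lifshitz_JP lif).
  - by move=> u v; rewrite !(brE lie) (lifshitz_JH lif) (JJ_dim2 lif) scaler0 addr0.
  - by move=> u v; rewrite !(brE lie) (lifshitz_JD lif) (JJ_dim2 lif) scaler0 addr0.
  - by move=> u; exact: spanned_P.
  - rewrite -[H](addrK (y *: J a b)); apply: spannedD; first exact: spanned_H.
    exact/spannedN/spannedZ.
  - rewrite -[D](addrK (x *: J a b)); apply: spannedD; first exact: spanned_D.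
    exact/spannedN/spannedZ.
clearbody H' D'.
have [co bco] := lifshitz_coordinates lif'.
have wDH : has_weight br J (fun=> false) (br D' H').
  apply: (weight_scalar lif') => u v.
  by rewrite (br_derivation lie) (lifshitz_JD lif') (lifshitz_JH lif') !(brE lie) addr0.
have [k [be [ce DH]]] := invariant_dim2 lif' wDH.
have wPP : has_weight br J (fun=> false) (br (P a) (P b)).
  have := weight_tensor lif' bco (tensor_family_PP lif' bco) (isT : a != b).
  move=> w u v uv; rewrite w // -/a -/b.
  by case: (ord2_cases u) (ord2_cases v) uv => -> [] -> .
have [l [mu [nu PP]]] := invariant_dim2 lif' wPP.
exists H', D', l, mu, nu, al, ga, be, ce; split=> //; split=> //.
  move=> u v; rewrite (antisym_dim2 u v (Y := fun u v => br (P u) (P v))); last first.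
    by move=> *; exact: (brC lie).
  rewrite PP (antisym_dim2 u v (JN lif)) -addrA scalerDr; congr (_ + _).
  by rewrite !scalerA mulrC.
(* Both D' and H' act on P by scalars, so [D', H'] acts by zero commutator; its J part would rotate
   P_a into P_b, hence [k = 0]. *)
have := br_derivation lie D' H' (P a).
rewrite gaE alE DH !(brE lie) gaE alE (lifshitz_JP lif).
rewrite /delta eqxx /= => /(congr1 (co^~ (inr (inl b)))).
rewrite !(coE bco) !(co_P_P bco) eqxx /= => e.
have -> : k = 0 by move: e; lra.
by rewrite scale0r add0r.
Qed.

Lemma prenormal_exists (R : realType) (d : nat) (V : lmodType R) (br : V -> V -> V)
  (J : 'I_d -> 'I_d -> V) (P : 'I_d -> V) (H D : V) : (2 <= d)%N ->
  lifshitz_lie_algebra br J P H D ->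
  exists P' H' D' l mu nu al ga be ce, prenormal_form br J P' H' D' l mu nu al ga be ce.
Proof.
case: d J P => [|[|[|d]]] // J P _ lif.
  have [H' [D' [l [mu [nu [al [ga [be [ce pre]]]]]]]]] := prenormal_dim2 lif.
  by exists P, H', D', l, mu, nu, al, ga, be, ce.
pose a : 'I_d.+3 := @Ordinal d.+3 0 isT; pose b : 'I_d.+3 := @Ordinal d.+3 1 isT.
pose c : 'I_d.+3 := @Ordinal d.+3 2 isT.
have [P' [l [lif' PP]]] : exists P' l, lifshitz_lie_algebra br J P' H D /\
    forall u v, br (P' u) (P' v) = l *: J u v.
  case: d J P lif @a @b @c => [|d] J P lif a b c.
    apply: (PP_dim3 lif (a := a) (b := b) (c := c)) => // x.
    by rewrite !inE -!val_eqE /=; case: x => [[|[|[|]]]].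
  pose e : 'I_d.+4 := @Ordinal d.+4 3 isT.
  have [l PP] := PP_dim_ge4 lif (isT : uniq [:: a; b; c; e]).
  by exists P, l.
have [al [ga [be [ce pre]]]] := prenormal_dim_ge3 (isT : uniq [:: a; b; c]) lif' PP.
by exists P', H, D, l, 0, 0, al, ga, be, ce.
Qed.

Section Normalization.
Variables (R : realType) (d : nat) (V : lmodType R) (br : V -> V -> V).
Implicit Types (J : 'I_d -> 'I_d -> V) (P : 'I_d -> V) (H D : V).

(** H' must span a line that contains [D, H] and acts trivially on P. If P is acted on nontrivially,
    the kernel of the action gives this line; otherwise [D, H] itself does, when nonzero. *)
Lemma prenormal_reduced J P H D l mu nu al ga b c : (0 < d)%N ->
  prenormal_form br J P H D l mu nu al ga b c ->
  exists H' D' mu' nu' al' b', prenormal_form br J P H' D' l mu' nu' al' 0 b' 0 /\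
    (al' = 1 \/ al' = 0 /\ (b' = 1 \/ b' = 0)).
Proof.
move=> d0 [[lif PP DP HP DH] dim]; have lie := lifshitz_lie lif.
have [co bco] := lifshitz_coordinates lif.
(* The change of basis has determinant one and so preserves [D, H]; (x, y) is the chosen direction
   of H'. *)
have rot x y : x ^+ 2 + y ^+ 2 != 0 ->
    let n := x ^+ 2 + y ^+ 2 in
    let H' := x *: H + y *: D in let D' := (- y / n) *: H + (x / n) *: D in
    [/\ lifshitz_lie_algebra br J P H' D',
        forall u v, br (P u) (P v) = l *: J u v +
          eps2 R u v *: (((mu * x + nu * y) / n) *: H' + (nu * x - mu * y) *: D'),
        forall u, br D' (P u) = ((x * al - y * ga) / n) *: P u,
        forall u, br H' (P u) = (x * ga + y * al) *: P u &
        br D' H' = br D H].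
  move=> n0 n H' D'; split.
  - apply: (lifshitz_rebase_scalars lif); rewrite /n.
    by have -> : x * (x / (x ^+ 2 + y ^+ 2)) - y * (- y / (x ^+ 2 + y ^+ 2)) = 1;
      [field | exact: oner_neq0].
  - move=> u v; rewrite PP; congr (_ + _ *: _).
    by apply: (co_inj bco) => i; rewrite !(coE bco) /n; field.
  - move=> u; rewrite !(brE lie) HP DP.
    by apply: (co_inj bco) => i; rewrite !(coE bco) /n; field.
  - move=> u; rewrite !(brE lie) HP DP.
    by apply: (co_inj bco) => i; rewrite !(coE bco); ring.
  - rewrite !(brE lie) !(brxx lie) [br H D](brC lie).
    by apply: (co_inj bco) => i; rewrite !(coE bco) /n; field.
have dim' x y : d != 2%N -> (mu * x + nu * y) / (x ^+ 2 + y ^+ 2) = 0 /\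
    nu * x - mu * y = 0.
  by move=> /dim[-> ->]; rewrite !mul0r addr0 mul0r subr0.
have sq0 (x y : R) : x ^+ 2 + y ^+ 2 = 0 -> x = 0 /\ y = 0.
  move=> /eqP; rewrite paddr_eq0 ?sqr_ge0 // !sqrf_eq0.
  by move=> /andP[/eqP-> /eqP->].
(* [D, H] acts trivially on P, as a commutator of scalars. *)
have rel : b * ga + c * al = 0.
  have := br_derivation lie D H (P (Ordinal d0)).
  rewrite DH !(brE lie) HP DP !(brE lie) HP DP.
  move=> /(congr1 (co^~ (inr (inl (Ordinal d0))))).
  rewrite !(coE bco) !(co_P_P bco) eqxx /= => e.
  by move: e; nra.
(* The direction (al, -ga) is the kernel of the action on P, and D' then has weight 1. By [rel],
   [D, H] is a multiple of H'. *)
have [n0|n0] := eqVneq (al ^+ 2 + (- ga) ^+ 2) 0; last first.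
  have [lif' PP' DP' HP' DH'] := rot _ _ n0.
  eexists _, _, _, _, 1, ((b * al - c * ga) / (al ^+ 2 + (- ga) ^+ 2)).
  split; last by left.
  split; last exact: (dim' al (- ga)).
  split; [exact: lif' | exact: PP' | | | ].
  - by move=> u; rewrite DP'; congr (_ *: _); field.
  - by move=> u; rewrite HP'; congr (_ *: _); ring.
  - rewrite DH' DH; apply: (co_inj bco) => i; rewrite !(coE bco).
    apply: (mulfI n0); move: rel => /eqP; rewrite addrC addr_eq0 => /eqP rel.
    have : (al ^+ 2 + (- ga) ^+ 2) * (b * co H i + c * co D i) -
      ((b * al - c * ga) * (al * co H i - ga * co D i)) =
      (b * ga + c * al) * (ga * co H i + al * co D i) by ring.
    rewrite rel addrN mul0r => /eqP; rewrite subr_eq0 => /eqP ->.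
    by field.
have [al0 /eqP ga0] := sq0 _ _ n0; rewrite oppr_eq0 in ga0.
have [n1|n1] := eqVneq (b ^+ 2 + c ^+ 2) 0.
  have [b0 c0] := sq0 _ _ n1.
  exists H, D, mu, nu, 0, 0; split; last by right; split=> //; right.
  split=> //; split=> // [u|u|].
  - by rewrite DP al0.
  - by rewrite HP (eqP ga0).
  - by rewrite DH b0 c0.
(* Here H' is [D, H] itself, so that [D', H'] = H'. *)
have [lif' PP' DP' HP' DH'] := rot _ _ n1.
eexists _, _, _, _, 0, 1; split; last by right; split=> //; left.
split; last exact: (dim' b c).
split; [exact: lif' | exact: PP' | | | ].
- by move=> u; rewrite DP' al0 (eqP ga0) !mulr0 subr0 mul0r.
- by move=> u; rewrite HP' al0 (eqP ga0) !mulr0 addr0.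
- by rewrite DH' DH scale1r scale0r addr0.
Qed.
End Normalization.

(** so(2) is abelian, so its generator may be shifted by a central element; the hypotheses make H
    and D central. *)
Lemma lifshitz_rebase_J (R : realType) (V : lmodType R) (br : V -> V -> V)
  (J : 'I_2 -> 'I_2 -> V) (P : 'I_2 -> V) (H D : V) (x y : R) :
  lifshitz_lie_algebra br J P H D ->
  (forall u, br D (P u) = 0) -> (forall u, br H (P u) = 0) -> br D H = 0 ->
  lifshitz_lie_algebra br (fun u v => J u v + eps2 R u v *: (x *: H + y *: D)) P H D.
Proof.
move=> lif DP HP DH; have lie := lifshitz_lie lif.
have HD : br H D = 0 by rewrite (brC lie) DH oppr0.
set J' := fun u v => _.
have epsN (u v : 'I_2) : eps2 R u v = - eps2 R v u.
  by case: (ord2_cases u) => ->; case: (ord2_cases v) => ->; rewrite /eps2 /= opprB.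
have J'N u v : J' u v = - J' v u.
  by rewrite /J' (JN lif) epsN scaleNr opprD.
have J'd u : J' u u = 0.
  exact: (eq_oppv_eq0 (J'N u u)).
apply: (lifshitz_rebase lif) => //.
- move=> u v f e; rewrite [LHS](_ : _ = 0); last first.
    rewrite /J' !(brE lie) (JJ_dim2 lif) (lifshitz_JH lif) (lifshitz_JD lif).
    rewrite (lifshitz_HJ lif) (lifshitz_DJ lif) DH HD !(brxx lie).
    by rewrite !(scaler0, addr0).
  case: (ord2_cases u) => ->; case: (ord2_cases v) => ->;
  case: (ord2_cases f) => ->; case: (ord2_cases e) => ->;
  rewrite /delta ?eqxx /= ?J'd ?(J'N ord_max ord0);
  rewrite ?(scale0r, scale1r, scaler0, subr0, addr0, sub0r, add0r, oppr0, opprK, subrr, addNr) //.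
- move=> u v f; rewrite /J' !(brE lie) DP HP (lifshitz_JP lif).
  by rewrite !(scaler0, addr0).
- move=> u v; rewrite /J' !(brE lie) (lifshitz_JH lif) DH (brxx lie).
  by rewrite !(scaler0, addr0).
- move=> u v; rewrite /J' !(brE lie) (lifshitz_JD lif) HD (brxx lie).
  by rewrite !(scaler0, addr0).
- move=> u v; have -> : J u v = J' u v - eps2 R u v *: (x *: H + y *: D).
    by rewrite /J' addrK.
  apply: spannedD; first exact: spanned_J.
  apply/spannedN/spannedZ/spannedD; apply: spannedZ.
    exact: spanned_H.
  exact: spanned_D.
- by move=> u; apply: spanned_P.
- exact: spanned_H.
- exact: spanned_D.
Qed.

(** Scaling P by k multiplies [s] by k^2, so only the sign of [s] survives. *)
Lemma normal_form_rescale (R : realType) (d : nat) (V : lmodType R) (br : V -> V -> V)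
  (J : 'I_d -> 'I_d -> V) (P : 'I_d -> V) (H D : V) s z p : s != 0 ->
  normal_form br J P H D s 0 z p ->
  exists P', normal_form br J P' H D (if 0 < s then 1 else -1) 0 z p.
Proof.
move=> s0 [lif PP DP HP DH]; have lie := lifshitz_lie lif.
have n0 : 0 < Num.sqrt `|s| by rewrite sqrtr_gt0 normr_gt0.
have k0 : (Num.sqrt `|s|)^-1 != 0 by rewrite invr_eq0 gt_eqF.
exists (fun u => (Num.sqrt `|s|)^-1 *: P u); split=> //.
- exact: (lifshitz_rebase_P lif).
- move=> u v; rewrite !(brE lie) PP !mul0r !scale0r !addr0 !scalerA; congr (_ *: _).
  rewrite -invfM -expr2 sqr_sqrtr //.
  case: ltrP => [sp|sn]; first by rewrite gtr0_norm // mulVf.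
  by rewrite ler0_norm // invrN mulNr mulVf.
- by move=> u; rewrite !(brE lie) DP !scalerA mulrC.
- by move=> u; rewrite !(brE lie) HP scaler0.
Qed.

Lemma normal_form_exists (R : realType) (d : nat) (V : lmodType R) (br : V -> V -> V)
  (J : 'I_d -> 'I_d -> V) (P : 'I_d -> V) (H D : V) : (2 <= d)%N ->
  lifshitz_lie_algebra br J P H D ->
  exists (L : lifshitz_label R) J' P' H' D', admissible d L /\
    @normal_form R d V br J' P' H' D' (PPJ L) (PPH L) (DHc L) (DPc L).
Proof.
move=> d2 /(prenormal_exists d2)[{}P [{}H [{}D [l [mu [nu [al [ga [b [c pre]]]]]]]]]].
have [{}H [{}D [{}mu [{}nu [{}al [{}b [{}pre cases]]]]]]] := prenormal_reduced (ltnW d2) pre.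
have [[lif PP DP HP DH] dim] := pre; have lie := lifshitz_lie lif.
rewrite scale0r addr0 in DH.
have {}HP u : br H (P u) = 0 by rewrite HP scale0r.
have [co bco] := lifshitz_coordinates lif.
pose i0 : 'I_d := Ordinal (ltnW d2); pose i1 : 'I_d := Ordinal d2.
have eps01 : eps2 R i0 i1 = 1 by rewrite /eps2 /= subr0.
pose p : Jidx d := exist (fun p : 'I_d * 'I_d => (val p.1 < val p.2)%N) (i0, i1) isT.
have PP01 : br (P i0) (P i1) = l *: J i0 i1 + (mu *: H + nu *: D).
  by rewrite PP eps01 scale1r.
have HD : br H D = - (b *: H) by rewrite (brC lie) DH.
have coJ : co (J i0 i1) (inl p) = 1 by rewrite (co_basis bco (inl p) (inl p)) eqxx.
(* D acts on [P_0, P_1] with weight 2 [al]; the three equations are the J, H and D components. *)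
have [al_l al_mu al_nu] : [/\ al * l = 0, mu * b = 2%:R * al * mu & al * nu = 0].
  have := br_derivation lie D (P i0) (P i1).
  rewrite !DP !(brE lie) PP01 !(brE lie) (lifshitz_DJ lif) DH (brxx lie) => e.
  split.
  - move: e => /(congr1 (co^~ (inl p))); rewrite !(coE bco) (co_H bco) (co_D bco) coJ /=; lra.
  - move: e => /(congr1 (co^~ (inr (inr false)))).
    rewrite !(coE bco) (co_H bco) (co_D bco) (co_J_other lif bco) /=; lra.
  - move: e => /(congr1 (co^~ (inr (inr true)))).
    rewrite !(coE bco) (co_H bco) (co_D bco) (co_J_other lif bco) /=; lra.
have nu_b : nu * b = 0.
  have := br_derivation lie H (P i0) (P i1).
  rewrite !HP !(brE lie) PP01 !(brE lie) (lifshitz_HJ lif) HD (brxx lie).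
  move=> /(congr1 (co^~ (inr (inr false)))); rewrite !(coE bco) (co_H bco) /=; lra.
case: cases => [al1|[al0 [b1|b0]]]; subst.
- have l0 : l = 0 by move: al_l; rewrite mul1r.
  have nu0 : nu = 0 by move: al_nu; rewrite mul1r.
  have [mu0|mu0] := eqVneq mu 0.
    exists (LA3 b), J, P, H, D; split=> //; split=> // u v.
    by rewrite /= PP l0 mu0 nu0 !(mul0r, scale0r, addr0, scaler0).
  have dE : d = 2%N by apply/eqP; apply: contraNT mu0 => /dim[-> _].
  (* H occurs in [P, P], so its weight under D is twice that of P. *)
  have b2 : b = 2%:R by apply: (mulfI mu0); rewrite al_mu mulr1 mulrC.
  have lif' : lifshitz_lie_algebra br J P (mu *: H) D.
    have := lifshitz_rebase_scalars lif (x := mu) (y := 0) (u := 0) (w := 1).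
    by rewrite !scale0r add0r addr0 scale1r; apply; rewrite mulr1 mul0r subr0.
  exists LA7, J, P, (mu *: H), D; split=> //; split=> //= [u v|u|].
  + by rewrite PP l0 nu0 !scale0r addr0 mul1r.
  + by rewrite !(brE lie) HP scaler0.
  + by rewrite !(brE lie) DH b2 !scalerA mulrC.
- have mu0 : mu = 0 by move: al_mu; rewrite mulr1 mulr0 mul0r.
  have nu0 : nu = 0 by move: nu_b; rewrite mulr1.
  have nf : normal_form br J P H D l 0 1 0.
    split=> // u v.
    by rewrite /= PP mu0 nu0 !(mul0r, scale0r, addr0, scaler0).
  have [l0|l0] := eqVneq l 0.
    by exists LA2, J, P, H, D; split=> //; rewrite l0 in nf.
  have [P' nf'] := normal_form_rescale l0 nf.
  by exists (LA5 R (0 < l)), J, P', H, D; split.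
- have [l0|l0] := eqVneq l 0.
    have [n0|n0] := eqVneq (mu ^+ 2 + nu ^+ 2) 0.
      move: n0 => /eqP; rewrite paddr_eq0 ?sqr_ge0 // !sqrf_eq0 => /andP[/eqP mu0 /eqP nu0].
      exists LA1, J, P, H, D; split=> //; split=> // u v.
      by rewrite /= PP mu0 nu0 l0 !(mul0r, scale0r, addr0, scaler0).
    have dE : d = 2%N.
      apply/eqP; apply: contraNT n0 => /dim[-> ->].
      by rewrite expr0n addr0.
    set n := mu ^+ 2 + nu ^+ 2 in n0.
    have lif' := lifshitz_rebase_scalars lif (x := mu) (y := nu) (u := - nu / n) (w := mu / n).
    exists LA6, J, P, (mu *: H + nu *: D), ((- nu / n) *: H + (mu / n) *: D).
    split=> //; split=> /=.
    + apply: lif'; have -> : mu * (mu / n) - nu * (- nu / n) = 1 by rewrite /n; field.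
      exact: oner_neq0.
    + by move=> u v; rewrite PP l0 scale0r mul1r.
    + by move=> u; rewrite !(brE lie) HP DP !scale0r !scaler0 addr0.
    + by move=> u; rewrite !(brE lie) HP DP !scale0r !scaler0 addr0.
    + rewrite !(brE lie) DH HD !(brxx lie) !scale0r oppr0 !scaler0 !addr0.
      by [].
  (* In dimension two the central term [mu H + nu D] is absorbed in J after division by [l]. *)
  have [J' nf] : exists J', normal_form br J' P H D l 0 0 0.
    have [dE|dN] := eqVneq d 2%N; last first.
      have [mu0 nu0] := dim dN; exists J; split=> // u v.
      by rewrite /= PP mu0 nu0 !(mul0r, scale0r, addr0, scaler0).
    move: J P lif PP DP HP {dim PP01 co bco i0 i1 eps01 p coJ pre d2}; subst d.
    move=> J P lif PP DP HP.
    exists (fun u v => J u v + eps2 R u v *: ((mu / l) *: H + (nu / l) *: D)).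
    split=> //.
    + apply: lifshitz_rebase_J => // [u|]; rewrite ?DP ?DH scale0r //.
    + move=> u v; rewrite PP mul0r scale0r addr0 !scalerDr !scalerA.
      by congr (_ + (_ *: _ + _ *: _)); field.
  have [P' nf'] := normal_form_rescale l0 nf.
  by exists (LA4 R (0 < l)), J', P', H, D; split.
Qed.

(** * Killing form and adjoint trace of a normal form *)

Section KillingForm.
Variables (R : realType) (d : nat) (V : lmodType R) (br : V -> V -> V).
Variables (J : 'I_d -> 'I_d -> V) (P : 'I_d -> V) (H D : V) (s m z p : R).
Hypothesis d2 : (2 <= d)%N.
Hypothesis nf : normal_form br J P H D s m z p.
Hypothesis dim : m != 0 -> d = 2%N.
Local Notation fam := (lif_family J P H D).
Variable co : V -> Idx d -> R.
Hypothesis bco : coordinates fam co.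
Let lif : lifshitz_lie_algebra br J P H D. Proof. by case: nf. Qed.
Let lie := lifshitz_lie lif.
Local Notation iH := (inr (inr false) : Idx d).
Local Notation iD := (inr (inr true) : Idx d).

Lemma nf_PP a b : br (P a) (P b) = s *: J a b + (m * eps2 R a b) *: H.
Proof. by case: nf. Qed.
Lemma nf_DP a : br D (P a) = p *: P a. Proof. by case: nf. Qed.
Lemma nf_HP a : br H (P a) = 0. Proof. by case: nf. Qed.
Lemma nf_DH : br D H = z *: H. Proof. by case: nf. Qed.
Lemma nf_PD a : br (P a) D = - (p *: P a). Proof. by rewrite (brC lie) nf_DP. Qed.
Lemma nf_PH a : br (P a) H = 0. Proof. by rewrite (brC lie) nf_HP oppr0. Qed.
Lemma nf_HD : br H D = - (z *: H). Proof. by rewrite (brC lie) nf_DH. Qed.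

Definition nfE := (lifshitz_JJ lif, lifshitz_JP lif, lifshitz_JH lif, lifshitz_JD lif,
  lifshitz_PJ lif, lifshitz_HJ lif, lifshitz_DJ lif,
  nf_PP, nf_DP, nf_HP, nf_DH, nf_PD, nf_PH, nf_HD, brxx lie).

Lemma br_expand x y :
  br x y = \sum_i \sum_j (co x i * co y j) *: br (fam i) (fam j).
Proof.
rewrite -{1}(coK bco x) (br_suml lie); apply: eq_bigr => i _.
rewrite -{1}(coK bco y) (br_sumr lie) scaler_sumr; apply: eq_bigr => j _.
by rewrite scalerA.
Qed.

Lemma br_H x : br x H = (z * co x iD) *: H.
Proof.
rewrite -{1}(coK bco x) (br_suml lie) (bigD1 iD) //= nf_DH scalerA mulrC.
rewrite big1 ?addr0 // => -[q|[a|[]]] //= _; by rewrite !nfE scaler0.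
Qed.

Lemma br_D x : p = 0 -> br x D = - (z * co x iH) *: H.
Proof.
move=> p0; rewrite -{1}(coK bco x) (br_suml lie) (bigD1 iH) //= nf_HD scalerN scalerA mulrC scaleNr.
rewrite big1 ?addr0 // => -[q|[a|[]]] //= _; by rewrite !nfE ?p0 ?scale0r ?oppr0 scaler0.
Qed.

Lemma co_bracket_D x y : co (br x y) iD = 0.
Proof.
rewrite br_expand.
have sum0 (f : Idx d -> V) : (forall i, co (f i) iD = 0) -> co (\sum_i f i) iD = 0.
  move=> f0; rewrite (big_morph (co^~ iD) (fun u v => coD bco u v iD) (co0 bco iD)).
  by rewrite big1.
apply: (sum0) => i; apply: (sum0) => j; rewrite (coZ bco).
have -> : co (br (fam i) (fam j)) iD = 0; last by rewrite mulr0.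
by case: i j => [q|[a|[]]] [q'|[b|[]]]; rewrite /= !nfE !(coE bco)
  ?(co_J_other lif bco) ?(co_P_scalar bco) ?(co_H bco) /= ?(mulr0, addr0, subr0, oppr0).
Qed.

Definition parity (c : 'I_d) (i : Idx d) : bool :=
  match i with
  | inl q => (c == (val q).1) (+) (c == (val q).2)
  | inr (inl a) => c == a
  | inr (inr true) => false
  | inr (inr false) => d == 2%N
  end.

(* The parities are those of the reflection of the c-th axis.  For d = 2 that
   reflection reverses the sign of epsilon, hence that of H. *)
Definition homogeneous (c : 'I_d) (e : bool) x := forall k, co x k != 0 -> parity c k = e.

Lemma homogeneous0 c e : homogeneous c e 0.
Proof. by move=> k; rewrite (co0 bco) eqxx. Qed.

Lemma homogeneousD c e x y : homogeneous c e x -> homogeneous c e y -> homogeneous c e (x + y).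
Proof.
move=> hx hy k; rewrite (coD bco).
have [x0|/hx//] := eqVneq (co x k) 0; have [y0|/hy//] := eqVneq (co y k) 0.
by rewrite x0 y0 addr0 eqxx.
Qed.

(** The premise is conditional so that a coefficient [delta] may supply the equality of indices
    under which the parities agree. *)
Lemma homogeneousZ c e t x : (t != 0 -> homogeneous c e x) -> homogeneous c e (t *: x).
Proof. by move=> hx k; rewrite (coZ bco) mulf_eq0 negb_or => /andP[/hx h /h]. Qed.

Lemma homogeneousN c e x : homogeneous c e x -> homogeneous c e (- x).
Proof. by move=> hx; rewrite -scaleN1r; apply: homogeneousZ. Qed.

Lemma homogeneous_fam c i : homogeneous c (parity c i) (fam i).
Proof. by move=> k; rewrite (co_basis bco); have [->//|_] := eqVneq k i; rewrite eqxx. Qed.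

Lemma homogeneous_J c a b : homogeneous c ((c == a) (+) (c == b)) (J a b).
Proof.
case: (ltngtP a b) => [lt|lt|/val_inj ->].
- exact: (@homogeneous_fam c (inl (exist _ (a, b) lt))).
- rewrite addbC (JN lif); apply: homogeneousN.
  exact: (@homogeneous_fam c (inl (exist _ (b, a) lt))).
- by rewrite (Jdiag lif); apply: homogeneous0.
Qed.

Lemma homogeneous_P c a : homogeneous c (c == a) (P a).
Proof. exact: (@homogeneous_fam c (inr (inl a))). Qed.

Lemma homogeneous_H c : homogeneous c (d == 2%N) H.
Proof. exact: (@homogeneous_fam c (iH)). Qed.

Lemma delta_neq0 (a b : 'I_d) : delta R a b != 0 -> a = b.
Proof. by rewrite /delta; have [//|_] := eqVneq a b; rewrite eqxx. Qed.

Lemma homogeneous_JJ c a b u v :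
  homogeneous c ((c == a) (+) (c == b) (+) ((c == u) (+) (c == v))) (br (J a b) (J u v)).
Proof.
rewrite (lifshitz_JJ lif); repeat apply: homogeneousD; try apply: homogeneousN;
  apply: homogeneousZ => /delta_neq0 e;
  match goal with |- homogeneous _ _ (J ?a' ?b') => move: (@homogeneous_J c a' b') end;
  congr homogeneous; subst;
  by repeat match goal with |- context [c == ?w] => case: (c == w) end.
Qed.

Lemma homogeneous_JP c a b u :
  homogeneous c ((c == a) (+) (c == b) (+) (c == u)) (br (J a b) (P u)).
Proof.
rewrite (lifshitz_JP lif); apply: homogeneousD; last apply: homogeneousN.
all: apply: homogeneousZ => /delta_neq0 e.
all: match goal with |- homogeneous _ _ (P ?a') => move: (@homogeneous_P c a') end.
all: by congr homogeneous; subst; rewrite ?addbK // addbAC addbb.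
Qed.

Lemma homogeneous_PP c a b : homogeneous c ((c == a) (+) (c == b)) (br (P a) (P b)).
Proof.
rewrite nf_PP; apply: homogeneousD; apply: homogeneousZ; first by move=> _; exact: homogeneous_J.
rewrite mulf_eq0 negb_or => /andP[/dim dE eps0].
suff -> : (c == a) (+) (c == b) = (d == 2%N) by exact: homogeneous_H.
have c2 : (val c < 2)%N by apply: (leq_trans (ltn_ord c)); rewrite dE.
have -> : (d == 2%N) = true by rewrite dE.
move: eps0 c2; rewrite -!val_eqE /eps2.
case: (val c) => [|[|//]]; case: (val a) => [|[|?]]; case: (val b) => [|[|?]];
  by rewrite /= ?subrr ?eqxx.
Qed.

(** This says that the reflection of the c-th axis is an automorphism; the H term of [P_a, P_b]
    obeys it because epsilon occurs only for d = 2. *)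
Lemma homogeneous_br c i j : homogeneous c (parity c i (+) parity c j) (br (fam i) (fam j)).
Proof.
have h0 e : homogeneous c e 0 by exact: homogeneous0.
have comm k l : homogeneous c (parity c k (+) parity c l) (br (fam k) (fam l)) ->
  homogeneous c (parity c l (+) parity c k) (br (fam l) (fam k)).
  by move=> h; rewrite addbC (brC lie); apply: homogeneousN.
have hJP q a : homogeneous c (parity c (inl q) (+) (c == a)) (br (fam (inl q)) (P a)).
  exact: homogeneous_JP.
have hJ0 q t : homogeneous c (parity c (inl q) (+) parity c (inr (inr t)))
    (br (fam (inl q)) (fam (inr (inr t)))).
  by case: t; rewrite /= !nfE.
have hP0 t a : homogeneous c (parity c (inr (inr t)) (+) (c == a))
    (br (fam (inr (inr t))) (P a)).
  case: t; rewrite /= !nfE //; apply: homogeneousZ => _; exact: homogeneous_P.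
have hDH : homogeneous c (parity c iD (+) parity c iH) (br D H).
  rewrite nf_DH; apply: homogeneousZ => _; exact: homogeneous_H.
case: i j => [q|[a|t]] [q'|[b|t']].
- exact: homogeneous_JJ.
- exact: hJP.
- exact: hJ0.
- by apply: comm; exact: hJP.
- exact: homogeneous_PP.
- by apply: comm; exact: hP0.
- by apply: comm; exact: hJ0.
- exact: hP0.
- case: t t' => [] [].
  + by rewrite /= (brxx lie).
  + exact: hDH.
  + by apply: comm; exact: hDH.
  + by rewrite /= (brxx lie).
Qed.

Lemma homogeneous_ad c i e x : homogeneous c e x ->
  homogeneous c (parity c i (+) e) (br (fam i) x).
Proof.
move=> hx; rewrite -(coK bco x) (br_sumr lie).
apply: (big_ind (homogeneous c (parity c i (+) e))) => [|u v|k _].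
- exact: homogeneous0.
- exact: homogeneousD.
- by apply: homogeneousZ => /hx <-; exact: homogeneous_br.
Qed.

Definition killing x y := trace_in fam co (fun v => br x (br y v)).
Definition ad_trace x := trace_in fam co (br x).

Lemma sum_Idx (f : Idx d -> R) : \sum_i f i =
  \sum_q f (inl q) + (\sum_a f (inr (inl a)) + (f iD + f iH)).
Proof. by rewrite !big_sumType /= big_bool. Qed.

Lemma ad_traceE x : ad_trace x = (z + d%:R * p) * co x iD.
Proof.
have ad_fam i : ad_trace (fam i) = (z + d%:R * p) * (i == iD)%:R.
  (* ad of an odd vector changes parity, so its diagonal entries vanish. *)
  have odd c : parity c i -> i != iD -> ad_trace (fam i) = (z + d%:R * p) * (i == iD)%:R.
    move=> pc /negPf ->; rewrite mulr0 /ad_trace /trace_in big1 // => k _.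
    apply/eqP; apply/negPn/negP => /(homogeneous_br c).
    by rewrite pc; case: (parity c k).
  case: i odd => [[[u v] uv]|[a|[]]] odd.
  - apply: (odd u) => //=; rewrite eqxx.
    by have /negPf -> : u != v by apply/eqP => e; move: (uv); rewrite /= e ltnn.
  - by apply: (odd a); rewrite //= eqxx.
  - rewrite /ad_trace /trace_in sum_Idx /= ?eqxx mulr1.
    rewrite [X in X + _]big1 => [|q _]; last by rewrite nfE (co0 bco).
    under eq_bigr do rewrite nf_DP (coZ bco) (co_P_P bco) eqxx mulr1.
    rewrite sumr_const card_ord !nfE !(coE bco) (co_H bco) ?eqxx /= -mulr_natl; ring.
  - rewrite /ad_trace /trace_in big1 ?mulr0 // => -[q|[a|[]]] _; rewrite /= !nfE.
    + by rewrite (co0 bco).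
    + by rewrite (co0 bco).
    + by rewrite !(coE bco) (co_H bco) mulr0 oppr0.
    + by rewrite (co0 bco).
transitivity (\sum_i co x i * ad_trace (fam i)).
  rewrite /ad_trace /trace_in; under [RHS]eq_bigr do rewrite mulr_sumr.
  rewrite exchange_big; apply: eq_bigr => k _ /=.
  by rewrite -{1}(coK bco x) (br_suml lie) (co_sum bco).
rewrite (bigD1 iD) //= (ad_fam iD) eqxx mulr1 big1 ?addr0 1?mulrC // => i /negPf iN.
by rewrite ad_fam iN !mulr0.
Qed.

Lemma killing_expand x y :
  killing x y = \sum_i \sum_j co x i * co y j * killing (fam i) (fam j).
Proof.
transitivity (\sum_i co x i * killing (fam i) y).
  rewrite /killing /trace_in; under [RHS]eq_bigr do rewrite mulr_sumr.
  rewrite exchange_big; apply: eq_bigr => k _ /=.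
  by rewrite -{1}(coK bco x) (br_suml lie) (co_sum bco).
apply: eq_bigr => i _; under [RHS]eq_bigr do rewrite -mulrA.
rewrite -mulr_sumr; congr (_ * _).
rewrite /killing /trace_in; under [RHS]eq_bigr do rewrite mulr_sumr.
rewrite exchange_big; apply: eq_bigr => k _ /=.
by rewrite -{1}(coK bco y) (br_suml lie) (br_sumr lie) (co_sum bco).
Qed.

(** ad H sees only the D component, and brackets have none. *)
Lemma killing_Hl y : killing H y = 0.
Proof.
rewrite /killing /trace_in big1 // => k _; rewrite (brC lie) br_H co_bracket_D.
by rewrite mulr0 scale0r oppr0 (co0 bco).
Qed.

Lemma killing_Hr x : killing x H = 0.
Proof.
rewrite /killing /trace_in big1 // => k _.
rewrite (brC lie H) br_H (brNr lie) (brZr lie) br_H !(coE bco) (co_H bco) (co_basis bco).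
by case: (eqVneq k iH) => [->|_]; rewrite ?(mulr0, mul0r, oppr0).
Qed.

(** H is left out because its parities coincide with those of D for d distinct from 2, and with
    those of J_01 for d = 2. *)
Lemma parity_inj i j : i != iH -> j != iH ->
  (forall c, parity c i = parity c j) -> i = j.
Proof.
have uvN (u v : 'I_d) : (val u < val v)%N -> u != v.
  by move=> lt; apply/eqP => e; rewrite e ltnn in lt.
case: i j => [[[u v] uv]|[a|[]]] [[[u' v'] uv']|[a'|[]]] //= _ _ par;
  rewrite ?eqxx /= in par.
- have vu : v != u by rewrite eq_sym uvN.
  have := par v; have := par u; rewrite !eqxx (negPf (uvN _ _ uv)) (negPf vu) /=.
  move: (uv) (uv') => /= lt lt'.
  have [Eu|uu'] := eqVneq u u'; have [Ev|vv'] := eqVneq v v'.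
  + by move=> *; subst; congr (inl _); apply: val_inj.
  + subst u'; rewrite (negPf vu).
    by case: eqVneq.
  + subst v'; rewrite (negPf (uvN _ _ uv)).
    by case: eqVneq.
  + have [E1|//] := eqVneq u v'; have [E2|//] := eqVneq v u'; subst.
    by move: (ltn_trans lt lt'); rewrite ltnn.
- have vu : v != u by rewrite eq_sym uvN.
  have := par v; have := par u; rewrite !eqxx (negPf (uvN _ _ uv)) (negPf vu) /=.
  by move=> /esym/eqP ua /esym/eqP va; case/eqP: vu; rewrite ua va.
- by have := par u; rewrite eqxx (negPf (uvN _ _ uv)).
- have vu : v' != u' by rewrite eq_sym uvN.
  have := par v'; have := par u'; rewrite !eqxx (negPf (uvN _ _ uv')) (negPf vu) /=.
  by move=> /eqP ua /eqP va; case/eqP: vu; rewrite ua va.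
- by have := par a; rewrite eqxx => /esym/eqP ->.
- by have := par a; rewrite eqxx.
- by have := par u'; rewrite eqxx (negPf (uvN _ _ uv')).
- by have := par a'; rewrite eqxx.
Qed.

Lemma killing_offdiag i j : i != j -> killing (fam i) (fam j) = 0.
Proof.
move=> ij; have [->|iN] := eqVneq i iH; first exact: killing_Hl.
have [->|jN] := eqVneq j iH; first exact: killing_Hr.
(* For this c the product of the two adjoint operators reverses parity, so it has zero diagonal. *)
have [c pc] : exists c, parity c i != parity c j.
  apply/existsP; apply: contraT; rewrite negb_exists => /forallP par.
  by case/eqP: ij; apply: parity_inj => // c; apply/eqP; have := par c; rewrite negbK.
rewrite /killing /trace_in big1 // => k _; apply/eqP; apply/negPn/negP => nz.
have := homogeneous_ad (i := i) (homogeneous_br c (i := j) (j := k)) nz.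
by move: pc; case: (parity c i); case: (parity c j); case: (parity c k).
Qed.

Lemma killing_diag x y :
  killing x y = \sum_i killing (fam i) (fam i) * (co x i * co y i).
Proof.
rewrite killing_expand; apply: eq_bigr => i _.
rewrite (bigD1 i) //= big1 ?addr0 1?mulrC // => j ji.
by rewrite killing_offdiag ?mulr0 // eq_sym.
Qed.

Lemma killing_J q : killing (fam (inl q)) (fam (inl q)) < 0.
Proof.
case: q => [[u v] uv]; have uNv : u != v by apply/eqP => e; move: (uv); rewrite /= e ltnn.
rewrite /killing /trace_in /= -oppr_gt0 -sumrN.
under eq_bigr do rewrite (co_ad_J_square lif bco) // opprK (co_basis bco) eqxx mulr1.
(* P_u is moved by J_uv, which makes the sum strictly positive. *)
rewrite (bigD1 (inr (inl u))) //= eqxx eq_sym (negPf uNv) /=.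
by apply: ltr_wpDr => //; apply: sumr_ge0 => k _; rewrite ler0n.
Qed.

Lemma killing_P a : exists2 N : R, 0 < N & killing (P a) (P a) = s * N.
Proof.
(* The diagonal entries of (ad P_a)^2 divided by [s]: one for each J_uv involving a and one for each
   P_b other than P_a, in total 2 (d - 1). Only positivity of this number is used. *)
pose n (k : Idx d) : R := match k with
  | inl q => ((val q).1 == a)%:R + ((val q).2 == a)%:R
  | inr (inl b) => (b != a)%:R
  | _ => 0 end.
exists (\sum_k n k).
  have [b ba] : exists b : 'I_d, b != a.
    have [E|] := eqVneq a (Ordinal (ltnW d2)); last by rewrite eq_sym; exists (Ordinal (ltnW d2)).
    by exists (Ordinal d2); rewrite E.
  rewrite (bigD1 (inr (inl b))) //= ba; apply: ltr_wpDr => //.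
  by apply: sumr_ge0 => -[q|[c|[]]] _ //=; rewrite ?addr_ge0 ?ler0n.
rewrite /killing /trace_in mulr_sumr; apply: eq_bigr => -[[[u v] uv]|[b|[]]] _ /=.
- have uNv : u != v by apply/eqP => e; move: (uv); rewrite /= e ltnn.
  have coJ : co (J u v) (inl (exist _ (u, v) uv)) = 1.
    by have := co_basis bco (inl (exist _ (u, v) uv)) (inl (exist _ (u, v) uv)); rewrite eqxx.
  rewrite nfE !(brE lie) !nf_PP !(coE bco) (co_H bco) /delta.
  have [ua|ua] := eqVneq u a; have [va|va] := eqVneq v a; subst => /=.
  + by rewrite eqxx in uNv.
  + by rewrite coJ; ring.
  + by rewrite [J a u](JN lif) (coN bco) coJ; ring.
  + by ring.
- rewrite nf_PP !(brE lie) !nfE !(coE bco) !(co_P_P bco) /delta !eqxx eq_sym.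
  by have [_|_] := eqVneq a b; rewrite /= ?(co0 bco); ring.
- by rewrite nf_PD !(brE lie) (brxx lie) scaler0 oppr0 (co0 bco) mulr0.
- by rewrite nf_PH (br0r lie) (co0 bco) mulr0.
Qed.

Lemma killing_D : killing D D = d%:R * p ^+ 2 + z ^+ 2.
Proof.
rewrite /killing /trace_in sum_Idx /=.
rewrite [X in X + _]big1 => [|q _]; last by rewrite !(nfE, br0r lie) (co0 bco).
under eq_bigr do rewrite !(nf_DP, brZr lie) !(coZ bco) (co_P_P bco) eqxx mulr1.
rewrite sumr_const card_ord !(nfE, brZr lie, br0r lie) !(coE bco) (co_H bco) ?eqxx /= -mulr_natl.
ring.
Qed.
End KillingForm.

(** * The radical of the Killing form *)

Section KillingRadical.
Variables (R : realType) (d : nat) (V : lmodType R) (br : V -> V -> V).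
Variables (J : 'I_d -> 'I_d -> V) (P : 'I_d -> V) (H D : V) (s m z p : R).
Hypothesis d2 : (2 <= d)%N.
Hypothesis nf : normal_form br J P H D s m z p.
Hypothesis dim : m != 0 -> d = 2%N.
Local Notation fam := (lif_family J P H D).
Variable co : V -> Idx d -> R.
Hypothesis bco : coordinates fam co.
Let lif : lifshitz_lie_algebra br J P H D. Proof. by case: nf. Qed.
Let lie := lifshitz_lie lif.
Local Notation iH := (inr (inr false) : Idx d).
Local Notation iD := (inr (inr true) : Idx d).
Local Notation K := (killing br J P H D co).

Lemma killing_fam x i : K x (fam i) = K (fam i) (fam i) * co x i.
Proof.
rewrite (killing_diag nf dim bco) (bigD1 i) //= (co_basis bco) eqxx mulr1.
by rewrite big1 ?addr0 // => j /negPf ji; rewrite (co_basis bco) ji !mulr0.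
Qed.

Definition killing_radical x := forall y, K x y = 0.

Lemma radicalP x : killing_radical x <-> forall i, K (fam i) (fam i) * co x i = 0.
Proof.
split=> [rad i|rad y]; first by rewrite -killing_fam rad.
by rewrite (killing_diag nf dim bco) big1 // => i _; rewrite mulrA rad mul0r.
Qed.

Lemma radical_J x q : killing_radical x -> co x (inl q) = 0.
Proof.
move=> /radicalP/(_ (inl q))/eqP; rewrite mulf_eq0.
by rewrite lt_eqF ?(killing_J nf bco) // => /eqP.
Qed.

Lemma radical_P x a : s != 0 -> killing_radical x -> co x (inr (inl a)) = 0.
Proof.
move=> s0 /radicalP/(_ (inr (inl a)))/eqP /=.
have [N N0 ->] := killing_P d2 nf bco a.
by rewrite !mulf_eq0 (negPf s0) gt_eqF // => /eqP.
Qed.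

Lemma radical_D x : killing_radical x -> z != 0 \/ p != 0 -> co x iD = 0.
Proof.
move=> /radicalP/(_ iD)/eqP /= + zp; rewrite (killing_D nf bco) mulf_eq0.
suff n0 : d%:R * p ^+ 2 + z ^+ 2 != 0 by rewrite (negPf n0) => /eqP.
have dp : (0 : R) < d%:R by rewrite ltr0n; apply: leq_trans d2.
have dp2 : 0 <= d%:R * p ^+ 2 by rewrite mulr_ge0 ?sqr_ge0 ?ler0n.
rewrite (paddr_eq0 dp2 (sqr_ge0 z)) mulf_eq0 !sqrf_eq0 gt_eqF //=.
by rewrite negb_and; case: zp => ->; rewrite ?orbT.
Qed.

Lemma radical_of_P a : s = 0 -> killing_radical (P a).
Proof.
move=> s0; apply/radicalP => i.
have [->|ia] := eqVneq i (inr (inl a)).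
  by have [N _ /= ->] := killing_P d2 nf bco a; rewrite s0 !mul0r.
by rewrite (co_basis bco (inr (inl a)) i) (negPf ia) mulr0.
Qed.

Lemma radical_of_H : killing_radical H.
Proof. exact: (killing_Hl nf bco). Qed.

(** This detects [m]: for s = 0 all P_a lie in the radical, and they fail to commute exactly when
    [m] is nonzero. *)
Lemma radical_abelian x y : s = 0 -> m = 0 -> killing_radical x -> killing_radical y ->
  br x y = 0.
Proof.
move=> s0 m0 rx ry; rewrite (br_expand nf bco) big1 // => i _; rewrite big1 // => j _.
have [zp|] := boolP ((z != 0) || (p != 0)).
  have xD : co x iD = 0 by apply: radical_D => //; exact/orP.
  have yD : co y iD = 0 by apply: radical_D => //; exact/orP.
  by case: i j => [q|[a|[]]] [q'|[b|[]]];
    rewrite ?radical_J ?xD ?yD ?mul0r ?mulr0 ?scale0r //= !(nfE nf) ?s0 ?m0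
    ?mul0r ?scale0r ?addr0 scaler0.
rewrite negb_or !negbK => /andP[/eqP z0 /eqP p0].
by case: i j => [q|[a|[]]] [q'|[b|[]]];
    rewrite ?radical_J ?mul0r ?mulr0 ?scale0r //= !(nfE nf) ?s0 ?m0 ?z0 ?p0
    ?mul0r ?scale0r ?addr0 ?oppr0 scaler0.
Qed.
End KillingRadical.

(** * Comparison of two normal forms of one algebra *)

Section Comparison.
Variables (R : realType) (d : nat) (V : lmodType R) (br : V -> V -> V).
Variables (J : 'I_d -> 'I_d -> V) (P : 'I_d -> V) (H D : V) (s m z p : R).
Variables (J' : 'I_d -> 'I_d -> V) (P' : 'I_d -> V) (H' D' : V) (s' m' z' p' : R).
Hypothesis d2 : (2 <= d)%N.
Hypothesis nf : normal_form br J P H D s m z p.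
Hypothesis nf' : normal_form br J' P' H' D' s' m' z' p'.
Hypotheses (dim : m != 0 -> d = 2%N) (dim' : m' != 0 -> d = 2%N).
Let lif : lifshitz_lie_algebra br J P H D. Proof. by case: nf. Qed.
Let lif' : lifshitz_lie_algebra br J' P' H' D'. Proof. by case: nf'. Qed.
Let lie := lifshitz_lie lif.
Local Notation iH := (inr (inr false) : Idx d).
Local Notation iD := (inr (inr true) : Idx d).
Let i0 : 'I_d := Ordinal (ltnW d2).
Let i1 : 'I_d := Ordinal d2.

Section WithCoordinates.
Variables co co' : V -> Idx d -> R.
Hypothesis bco : coordinates (lif_family J P H D) co.
Hypothesis bco' : coordinates (lif_family J' P' H' D') co'.

Lemma killing_change x y : killing br J P H D co x y = killing br J' P' H' D' co' x y.
Proof.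
apply: trace_in_change => // k u v.
by rewrite !(brE lie).
Qed.

Lemma ad_trace_change x : ad_trace br J P H D co x = ad_trace br J' P' H' D' co' x.
Proof. by apply: trace_in_change => // k u v; rewrite !(brE lie). Qed.

Lemma radical_change x : killing_radical br J P H D co x ->
  killing_radical br J' P' H' D' co' x.
Proof. by move=> rad y; rewrite -killing_change. Qed.

(* A radical vector on which some (ad y)^2 acts as -1 exists iff s = 0. *)
Lemma compare_s0 : s' * p' = 0 -> s = 0 -> s' = 0.
Proof.
move=> sp s0; apply/eqP; apply/negPn/negP => s'0.
have p'0 : p' = 0 by move: sp => /eqP; rewrite mulf_eq0 (negPf s'0) => /eqP.
set x := P i0; set y := J i0 i1.
have rad : killing_radical br J' P' H' D' co' x.
  exact: (radical_change (radical_of_P d2 nf dim bco i0 s0)).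
have yyx : br y (br y x) = - x.
  by rewrite /y /x (ad_square_vector lif bco _ (vector_family_P lif)) ?eqxx //= scale1r.
(* As s' is nonzero, the radical lies in the span of H' and D'; with p' = 0, every ad y maps this
   span into the line of H'. *)
have xE : x = co' x iH *: H' + co' x iD *: D'.
  rewrite {1}(expand_support bco' (x := x) (s := [:: iH; iD])) //.
    by rewrite big_cons big_seq1.
  case=> [q|[a|[]]] //.
    by rewrite (radical_J nf' dim' bco' q rad) eqxx.
  by rewrite (radical_P d2 nf' dim' bco' a s'0 rad) eqxx.
have [t yx] : exists t, br y x = t *: H'.
  exists (co' x iH * (z' * co' y iD) + co' x iD * - (z' * co' y iH)).
  rewrite {1}xE !(brE lie) (br_H nf' bco') (br_D nf' bco' _ p'0).
  by rewrite !scalerA -scalerDl.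
have [r xH] : exists r, x = r *: H'.
  exists (- (t * (z' * co' y iD))); rewrite scaleNr -scalerA -(br_H nf' bco').
  by rewrite -(brZr lie) -yx yyx opprK.
(* Since x = - [y, [y, x]] lies on that line, it is a real eigenvector of ad y, and its eigenvalue
   would have square -1. *)
have yxx : br y x = (z' * co' y iD) *: x.
  by rewrite {1}xH (brZr lie) (br_H nf' bco') xH !scalerA mulrC.
move: yyx; rewrite yxx (brZr lie) yxx scalerA => /eqP.
rewrite -subr_eq0 opprK -{2}[x]scale1r -scalerDl scaler_eq0.
have /negPf -> : x != 0 := basis_neq0 bco (inr (inl i0)).
by rewrite orbF gt_eqF // ltr_wpDl // -expr2 sqr_ge0.
Qed.

(** For s' < 0 only D' can have positive Killing norm. P_0 is a bracket, so it has no D' component,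
    yet its norm is positive. *)
Lemma compare_s_sign : 0 < s -> s' < 0 -> False.
Proof.
move=> s0 s'0; pose x := P i0.
have xE : x = br (J i0 i1) (P i1).
  by rewrite (lifshitz_JP lif) /delta eqxx /= scale1r scale0r subr0.
have [N N0 KN] := killing_P d2 nf bco i0.
have : 0 < killing br J P H D co x x by rewrite /x KN mulr_gt0.
rewrite killing_change (killing_diag nf' dim' bco') ltNge => /negP; apply.
apply: sumr_le0 => i _; rewrite -expr2.
have [->|iN] := eqVneq i iD.
  by rewrite xE (co_bracket_D nf' bco') expr0n mulr0.
apply: mulr_le0_ge0; last exact: sqr_ge0.
case: i iN => [q|[a|[]]] //= _.
- exact/ltW/(killing_J nf' bco').
- have [N' N'0 ->] := killing_P d2 nf' bco' a.
  by rewrite mulr_le0_ge0 // ltW.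
- by rewrite (killing_Hl nf' bco').
Qed.

(** The hypotheses make the Killing form negative semidefinite, whereas D' has norm d p'^2 +
    z'^2. *)
Lemma compare_zp0 : s = 0 -> z = 0 -> p = 0 -> z' = 0 /\ p' = 0.
Proof.
move=> s0 z0 p0.
have : killing br J' P' H' D' co' D' D' <= 0.
  rewrite -killing_change (killing_diag nf dim bco).
  apply: sumr_le0 => i _; rewrite -expr2; apply: mulr_le0_ge0; last exact: sqr_ge0.
  case: i => [q|[a|[]]] //=.
  - exact/ltW/(killing_J nf bco).
  - by have [N' N'0 ->] := killing_P d2 nf bco a; rewrite s0 mul0r.
  - by rewrite (killing_D nf bco) z0 p0 expr0n mulr0 addr0.
  - by rewrite (killing_Hl nf bco).
rewrite (killing_D nf' bco') => le0.
have dp : (0 : R) < d%:R by rewrite ltr0n; apply: leq_trans d2.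
have dp2 : 0 <= d%:R * p' ^+ 2 by rewrite mulr_ge0 ?sqr_ge0 ?ler0n.
have : d%:R * p' ^+ 2 + z' ^+ 2 == 0.
  by rewrite eq_le le0 (addr_ge0 dp2 (sqr_ge0 z')).
rewrite (paddr_eq0 dp2 (sqr_ge0 z')) mulf_eq0 !sqrf_eq0 gt_eqF //=.
by move=> /andP[/eqP-> /eqP->].
Qed.

Lemma compare_m0 : s = 0 -> s' = 0 -> m = 0 -> m' = 0.
Proof.
move=> s0 s'0 m0.
have rad a : killing_radical br J P H D co (P' a).
  by move=> y; rewrite killing_change; apply: (radical_of_P d2 nf' dim' bco' a s'0).
have := radical_abelian d2 nf dim bco s0 m0 (rad i0) (rad i1).
rewrite (nf_PP nf') s'0 scale0r add0r /eps2 /= subr0 mulr1 => /eqP.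
rewrite scaler_eq0 => /orP[/eqP//|].
by rewrite (negPf (basis_neq0 bco' iH)).
Qed.

(** The factor is the D' coordinate of D. This separates a_4 from a_5, where s is nonzero and the
    Killing norm argument for z and p does not apply. *)
Lemma compare_trace : exists t, z + d%:R * p = (z' + d%:R * p') * t.
Proof.
exists (co' D iD); rewrite -(ad_traceE nf' dim' bco') -ad_trace_change.
by rewrite (ad_traceE nf dim bco) (co_D bco) eqxx mulr1.
Qed.

(* H spans the only one-dimensional ideal in the Killing radical, so the weight
   of the adjoint action on it is an invariant character, as is the trace. *)
Lemma compare_weights : s = 0 -> s' = 0 -> z' != 0 \/ p' != 0 ->
  exists t, z = z' * t /\ p = p' * t.
Proof.
move=> s0 s'0 zp'.
have rad : killing_radical br J' P' H' D' co' H.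
  exact: (radical_change (radical_of_H nf bco)).
have HD : co' H iD = 0 by exact: (radical_D d2 nf' dim' bco').
(* J'_ab maps H to a real multiple c H, while its square acts as -1 on the P'_a component; c^2 + 1 >
   0 forces that component to vanish. *)
have HP a : co' H (inr (inl a)) = 0.
  have [b ab] : exists b, a != b.
    have [->|] := eqVneq a i0; first by exists i1.
    by exists i0.
  have e := br_H nf bco (J' a b); set c := _ * _ in e.
  have := co_ad_J_square lif' bco' H (inr (inl a)) ab.
  rewrite e (brZr lie) e scalerA (coZ bco') /= eqxx [b == a]eq_sym (negPf ab) mul1r => /eqP.
  rewrite -subr_eq0 opprK -{2}[co' _ _]mul1r -mulrDl mulf_eq0.
  by rewrite gt_eqF /= => [/eqP//|]; rewrite ltr_wpDl // -expr2 sqr_ge0.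
have HE : H = co' H iH *: H'.
  rewrite {1}(expand_support bco' (x := H) (s := [:: iH])) ?big_seq1 //.
  case=> [q|[a|[]]] //.
  - by rewrite (radical_J nf' dim' bco' q rad) eqxx.
  - by rewrite HP eqxx.
  - by rewrite HD eqxx.
have zE : z = z' * co' D iD.
  have := nf_DH nf; rewrite [in LHS]HE (brZr lie) (br_H nf' bco') scalerA mulrC -scalerA.
  rewrite -HE => /eqP; rewrite -subr_eq0 -scalerBl scaler_eq0.
  by rewrite (negPf (basis_neq0 bco iH)) orbF subr_eq0 => /eqP.
exists (co' D iD); split=> //.
(* The traces z + d p and z' + d p' differ by the same factor as z and z', which leaves the relation
   for p. *)
have := ad_trace_change D.
rewrite (ad_traceE nf dim bco) (ad_traceE nf' dim' bco') (co_D bco) eqxx mulr1 mulrDl -zE.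
move=> /addrI; rewrite -mulrA => /mulfI; apply.
by rewrite pnatr_eq0 -lt0n; apply: leq_trans d2.
Qed.
End WithCoordinates.
End Comparison.

Lemma normal_form_label_unique (R : realType) (d : nat) (V : lmodType R) (br : V -> V -> V)
  (L L' : lifshitz_label R) J P H D J' P' H' D' : (2 <= d)%N ->
  admissible d L -> admissible d L' ->
  @normal_form R d V br J P H D (PPJ L) (PPH L) (DHc L) (DPc L) ->
  @normal_form R d V br J' P' H' D' (PPJ L') (PPH L') (DHc L') (DPc L') ->
  L = L'.
Proof.
move=> d2 adm adm' nf nf'.
have dim_adm (M : lifshitz_label R) : admissible d M -> PPH M != 0 -> d = 2%N.
  by case: M => //=; rewrite eqxx.
have sp (M : lifshitz_label R) : PPJ M * DPc M = 0.
  by case: M => [||?|?|?||] /=; rewrite ?(mul0r, mulr0).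
have dim := dim_adm _ adm; have dim' := dim_adm _ adm'.
have [co bco] : exists co, coordinates (lif_family J P H D) co.
  by case: nf => -[_ _ /basis_coordinates].
have [co' bco'] : exists co, coordinates (lif_family J' P' H' D') co.
  by case: nf' => -[_ _ /basis_coordinates].
have c1 := compare_s0 d2 nf nf' dim dim' bco bco' (sp L').
have c1' := compare_s0 d2 nf' nf dim' dim bco' bco (sp L).
have c2 := compare_s_sign d2 nf nf' dim' bco bco'.
have c2' := compare_s_sign d2 nf' nf dim bco' bco.
have c3 := compare_m0 d2 nf nf' dim dim' bco bco'.
have c3' := compare_m0 d2 nf' nf dim' dim bco' bco.
have c4 := compare_zp0 d2 nf nf' dim bco bco'.
have c4' := compare_zp0 d2 nf' nf dim' bco' bco.
have c5 := compare_weights d2 nf nf' dim dim' bco bco'.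
have c5' := compare_weights d2 nf' nf dim' dim bco' bco.
have c6 := compare_trace nf nf' dim dim' bco bco'.
have c6' := compare_trace nf' nf dim' dim bco' bco.
have n10 : (1 : R) != 0 := oner_neq0 R.
clear adm adm' nf nf' dim dim' sp dim_adm bco bco'.
(* Only numerical relations between the parameters remain; every pair of different constructors or
   signs contradicts one of them. *)
case: L c1 c1' c2 c2' c3 c3' c4 c4' c5 c5' c6 c6' => [||z|[]|[]||];
case: L' => [||z'|[]|[]||] /= c1 c1' c2 c2' c3 c3' c4 c4' c5 c5' c6 c6'; try by [];
try (exfalso; first
  [ by have /eqP := c1 erefl; rewrite ?oppr_eq0 oner_eq0
  | by have /eqP := c1' erefl; rewrite ?oppr_eq0 oner_eq0
  | by apply: c2; rewrite ?ltr01 ?ltrN10 | by apply: c2'; rewrite ?ltr01 ?ltrN10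
  | by have /eqP := c3 erefl erefl erefl; rewrite oner_eq0
  | by have /eqP := c3' erefl erefl erefl; rewrite oner_eq0
  | by case: (c4 erefl erefl erefl) => /eqP; rewrite oner_eq0
  | by case: (c4 erefl erefl erefl) => _ /eqP; rewrite oner_eq0
  | by case: (c4' erefl erefl erefl) => /eqP; rewrite oner_eq0
  | by case: (c4' erefl erefl erefl) => _ /eqP; rewrite oner_eq0
  | by case: c5 => // [|t [_]]; [left | lra]
  | by case: c5' => // [|t [_]]; [left | lra]
  | by case: c6 => t; lra | by case: c6' => t; lra ]).
(* Two algebras a_3: p = p' = 1 makes the common factor 1, so the parameters agree. *)
by case: c5 => // [|t [zE tE]]; [right | move: zE; rewrite mul1r in tE; rewrite -tE mulr1 => ->].
Qed.

Theorem theorem3p2 (R : realType) (d : nat) (V : lmodType R) (br : V -> V -> V)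
  (J : 'I_d -> 'I_d -> V) (P : 'I_d -> V) (H D : V) :
  (2 <= d)%N ->
  lifshitz_lie_algebra br J P H D ->
  exists! L : lifshitz_label R, admissible d L /\ iso_to_model d br L.
Proof.
move=> d2 lif; have lie := lifshitz_lie lif.
have [L [J' [P' [H' [D' [adm nf]]]]]] := normal_form_exists d2 lif.
exists L; split=> [|L' [adm' iso']].
  by split=> //; exact: (iso_of_normal_form lie nf).
have [J2 [P2 [H2 [D2 nf2]]]] := normal_form_of_iso lie iso'.
exact: (normal_form_label_unique d2 adm adm' nf nf2).
Qed.
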